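(* Let $p>0$. There exists $\eta_0\in(0,1)$, depending only on $p$, $\lambda$, $\kappa$ and the doubling constant $K_D$ of $X$, such that (in the setting described in the context) if there exists a function $\sigma:\mathcal S\to[0,\infty)$ satisfying (S1) for all $k\ge0$ and $B\in\mathcal S_k$, every path $\gamma=\{B_i\}_{i=1}^N$ in $\Gamma_{k+1}(B)$ satisfies $\sum_{i=1}^N\sigma(B_i)\ge1$, and (S2) for all $k\ge0$ and all $B\in\mathcal S_k$, $\sum_{B'\in T_k(B)}\sigma(B')^p\le\eta_0$, then there exists a distance $\theta$ on $X$ which is quasisymmetrically equivalent to $d$ and Ahlfors regular of dimension $p$. Therefore the Ahlfors regular conformal dimension of $X$ is smaller than or equal to $p$.
   Context: Setting. $(X,d)$ is a compact metric space (with at least two points), doubling with constant $K_D\ge1$ (every ball can be covered by at most $K_D$ balls of half the radius) and uniformly perfect with constant $K_P>1$ ($B(x,r)\setminus B(x,K_P^{-1}r)\ne\emptyset$ for all $x$ and $0<r\le\mathrm{diam}\,X$); $B(x,r)$ is the open ball. Fix $\kappa\ge1$, $\lambda\ge32$ and $a\ge6\kappa^2\max\{\lambda,K_P\}$; put $r_n=a^{-n}$. For $n\ge1$, $\mathcal S_n$ is a finite covering of $X$ such that each $B\in\mathcal S_n$ has a chosen center $x_B\in X$ with $B(x_B,\kappa^{-1}r_n)\subset B\subset B(x_B,\kappa r_n)$, and the balls $B(x_B,\kappa^{-1}r_n)$, $B\in\mathcal S_n$, are pairwise disjoint. $\mathcal S_0=\{w\}$, where $w$ represents the covering $\{X\}$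 and has a center $x_w\in X$, with the normalization $X=B(x_w,\kappa)$. $\mathcal S=\bigsqcup_{n\ge0}\mathcal S_n$. For $\mu>0$ and $B\in\mathcal S_n$, $\mu\cdot B:=B(x_B,\mu\kappa r_n)$. For $B,B'\in\mathcal S_n$, $B\sim B'$ means $\lambda\cdot B\cap\lambda\cdot B'\neq\emptyset$. Children. Let $X_n=\{x_B:B\in\mathcal S_n\}$ and $V_n(B)=\{y\in X:d(y,x_B)=\mathrm{dist}(y,X_n)\}$ for $B\in\mathcal S_n$. For each $B'\in\mathcal S_{n+1}$ choose once and for all one $B\in\mathcal S_n$ with $x_{B'}\in V_n(B)$, called its parent; $T_n(B)$ is the set of elements of $\mathcal S_{n+1}$ whose parent is $B$. Paths. A horizontal path of level $k$ is a sequence $B_1,\dots,B_N\in\mathcal S_k$ with $B_i\sim B_{i+1}$, $B_i\neq B_{i+1}$; $z_i$ denotes the center of $B_i$. For $B\in\mathcal S_k$, $\Gamma_{k+1}(B)$ is the family of horizontal paths of level $k+1$ such that $z_1\in B$ (with $w$ identified with $X$ if $k=0$), $z_i\in2\cdot B$ for $i=2,\dots,N-1$ and $z_N\in X\setminus2\cdot B$. Gauge. Two distances on $X$ are quasisymmetrically equivalent if the identity map between them is a quasisymmetric homeomorphism. A distance $\theta$ is Ahlfors regular of dimension $q>0$ if there are a Radon measure $\mu$ and $K\ge1$ with $K^{-1}\le\mu(B_r)/r^q\le K$ for every $\theta$-ball of radius $0<r\le\mathrm{diam}_\theta X$. The Ahlfors regular conformal dimension of $X$ is the infimum of $\dim_H(X,\theta)$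 over all Ahlfors regular $\theta$ quasisymmetrically equivalent to $d$. *)

(* Defs.v *)
From HB Require Import structures.
From mathcomp Require Import all_boot all_order all_algebra finmap.
From mathcomp Require Import all_classical all_reals all_analysis.

Set Implicit Arguments.
Unset Strict Implicit.
Unset Printing Implicit Defensive.

Import Order.TTheory GRing.Theory Num.Theory.
Import numFieldNormedType.Exports.

Local Open Scope classical_set_scope.
Local Open Scope ring_scope.

(* [ball x r] is the open ball, by [ballEmdist]. *)

Section metric_notions.
Context {R : realType}.

(* Extended-real valued; the [maxe] gives the empty set diameter 0. *)
Definition ediam {Y : metricType R} (A : set Y) : \bar R :=
  maxe 0%E (ereal_sup [set (mdist xy.1 xy.2)%:E | xy in A `*` A]).

Definition doubling (X : metricType R) (KD : R) :=
  forall (x : X) (r : R), 0 < r -> exists2 s : seq X,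
    (size s)%:R <= KD & ball x r `<=` \bigcup_(y in [set` s]) ball y (r / 2).

Definition uniformly_perfect (X : metricType R) (KP : R) :=
  forall (x : X) (r : R), 0 < r -> (r%:E <= ediam [set: X])%E ->
    ball x r `\` ball x (KP^-1 * r) !=set0.

Definition hausdorff_content (Y : metricType R) (s delta : R) (A : set Y) :
    \bar R :=
  ereal_inf [set (\sum_(0 <= i <oo) ediam (U i) `^ s)%E | U in
    [set U : (set Y)^nat | (forall i, (ediam (U i) <= delta%:E)%E) /\
                           A `<=` \bigcup_i U i]].

Definition hausdorff_measure (Y : metricType R) (s : R) (A : set Y) : \bar R :=
  ereal_sup [set hausdorff_content s delta A | delta in [set delta | 0 < delta]].

(* Restricting to exponents [0 < s] avoids the convention for [0 `^ 0]. *)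
Definition hausdorff_dim (Y : metricType R) : \bar R :=
  ereal_inf [set s%:E | s in
    [set s : R | 0 < s /\ hausdorff_measure s [set: Y] = 0%E]].

End metric_notions.

(* The library's measurable types are pointed, its metric types are not: the
   Borel type of a nonempty space carries the base point to be used. It has no
   influence on which sets are measurable. *)
Definition pointed_at (T : Type) (x0 : T) : Type := T.

HB.instance Definition _ (T : choiceType) (x0 : T) :=
  Choice.on (pointed_at x0).
HB.instance Definition _ (T : choiceType) (x0 : T) :=
  isPointed.Build (pointed_at x0) x0.

Definition borel {T : topologicalType} (x0 : T) :=
  g_sigma_algebraType (open : set (set (pointed_at x0))).

Section radon.
Context {R : realType} {T : topologicalType}.

Definition radon (x0 : T) (mu : {measure set (borel x0) -> \bar R}) :=
  [/\ forall K : set T, compact K -> (mu K < +oo)%E,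
      forall A : set (borel x0), measurable A ->
        mu A = ereal_inf [set mu U | U in [set U : set T | open U /\ A `<=` U]]
    & forall U : set T, open U ->
        mu U =
          ereal_sup [set mu K | K in [set K : set T | compact K /\ K `<=` U]]].

End radon.

Section ahlfors.
Context {R : realType}.

Definition ahlfors_regular (Y : metricType R) (q : R) :=
  exists (y0 : Y) (mu : {measure set (borel y0) -> \bar R}) (K : R),
    [/\ radon mu, 1 <= K
      & forall (y : Y) (r : R), 0 < r -> (r%:E <= ediam [set: Y])%E ->
          ((K^-1 * r `^ q)%:E <= mu (ball y r) /\
           mu (ball y r) <= (K * r `^ q)%:E)%E].

End ahlfors.

Section quasisymmetric.
Context {R : realType}.

Definition homeomorphism (T U : topologicalType) (f : T -> U) :=
  continuous f /\
  exists g : U -> T, [/\ cancel f g, cancel g f & continuous g].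

Definition distortion_function (eta : R -> R) :=
  [/\ set_bij `[0, +oo[ `[0, +oo[ eta,
      {in `[0, +oo[ &, {homo eta : s t / s < t}},
      {within `[0, +oo[, continuous eta}
    & exists2 zeta : R -> R,
        {in `[0, +oo[, cancel eta zeta} & {within `[0, +oo[, continuous zeta}].

Definition quasisymmetric (Y Z : metricType R) (f : Y -> Z) :=
  homeomorphism f /\
  exists2 eta : R -> R, distortion_function eta &
    forall x y z : Y, x != y ->
      mdist (f x) (f z) / mdist (f x) (f y) <= eta (mdist x z / mdist x y).

End quasisymmetric.

Record distance (R : realType) (T : Type) := Distance {
  dist_fun :> T -> T -> R;
  distance_xx : forall x, dist_fun x x = 0;
  distance_eq0 : forall x y, dist_fun x y = 0 -> x = y;
  distance_sym : forall x y, dist_fun x y = dist_fun y x;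
  distance_triangle : forall y x z,
    dist_fun x z <= dist_fun x y + dist_fun y z
}.

(* [metrized theta] is [T] with the metric and the topology of [theta]; any
   metric on [T] itself is forgotten. *)
Definition metrized (R : realType) (T : Type) (theta : distance R T) : Type := T.

HB.instance Definition _ (R : realType) (T : choiceType)
  (theta : distance R T) := Choice.on (metrized theta).
HB.instance Definition _ (R : realType) (T : choiceType)
    (theta : distance R T) :=
  isMetric.Build R (metrized theta) (distance_xx theta)
    (@distance_eq0 _ _ theta) (distance_sym theta)
    (distance_triangle theta).

Section gauge.
Context {R : realType} (X : metricType R).

Definition qs_equivalent (theta : distance R X) :=
  quasisymmetric (fun x : X => x : metrized theta).

Definition ar_conformal_dim : \bar R :=
  ereal_inf [set hausdorff_dim (metrized theta) | theta in
    [set theta : distance R X | qs_equivalent theta /\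
       exists2 q : R, 0 < q & ahlfors_regular (metrized theta) q]].

End gauge.

(* Since [a ^- 0 = 1] and the only element of level 0 is [X], for [n = 0] the
   field [center_outer] is the normalization X = B(x_w, kappa), and
   [center_inner], [level_cover], [inner_disjoint] say nothing. *)
Record covering_system (R : realType) (X : metricType R) (kappa a : R) :=
  CoveringSystem {
    level :> nat -> {fset set X};
    center : forall n, level n -> X;
    level0 : level 0%N = [fset [set: X]]%fset;
    level_cover : forall n, \bigcup_(B : level n) val B = [set: X];
    center_inner : forall n (B : level n),
      ball (center B) (kappa^-1 * a ^- n) `<=` val B;
    center_outer : forall n (B : level n),
      val B `<=` ball (center B) (kappa * a ^- n);
    inner_disjoint : forall n (B B' : level n), B != B' ->
      ball (center B) (kappa^-1 * a ^- n) `&`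
      ball (center B') (kappa^-1 * a ^- n) = set0
  }.

Section covering_system_theory.
Context {R : realType} {X : metricType R} {kappa a : R}
  (S : covering_system X kappa a).

Definition dilate (mu : R) n (B : S n) : set X :=
  ball (center B) (mu * kappa * a ^- n).

Definition neighbor (lambda : R) n (B B' : S n) :=
  dilate lambda B `&` dilate lambda B' !=set0.

Definition dist_centers n (y : X) : R :=
  inf [set mdist y (center B) | B in [set: S n]].

Definition voronoi n (B : S n) : set X :=
  [set y | mdist y (center B) = dist_centers n y].

Definition is_parent (parent : forall n, S n.+1 -> S n) :=
  forall n (B' : S n.+1), voronoi (parent n B') (center B').

Definition horizontal_path (lambda : R) n (gamma : seq (S n)) :=
  sorted (fun B B' => `[< neighbor lambda B B' >] && (B != B')) gamma.

(* For gamma = [:: B1, ..., BN], [behead (belast B1 gamma')] lists B2, ...,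
   B(N-1), and [last B1 gamma'] is BN. *)
Definition Gamma (lambda : R) k (B : S k) : set (seq (S k.+1)) :=
  [set gamma | horizontal_path lambda gamma /\
    if gamma is B1 :: gamma' then
      [/\ val B (center B1),
          forall C, C \in behead (belast B1 gamma') -> dilate 2 B (center C)
        & ~ dilate 2 B (center (last B1 gamma'))]
    else False].

End covering_system_theory.

(* Main.v *)
(* For B in S_n with center z_B put r_n = a^-n.  From sigma one builds, level by
   level, positive weights m on the cells such that
   - log m is Lipschitz at level n for the distance d / r_n,
   - the weights of the children of a cell add up to its own weight,
   - pi = m^(1/p) satisfies the crossing inequality
     sum_(i < N) pi(B_i) >= pi(B) along the paths of Gamma(B).
   The first property comes from smoothing sigma^p with the kernel
   exp(- s d(z_B, z_B') / r_n), whose mass is controlled by doubling; the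
   smallness of eta_0 leaves room to add weight at the center of every cell
   until the children add up.  The exact constant 1 in the crossing inequality
   lets chains of cells be replaced by chains of coarser cells without
   increasing their pi-length, so the chain metric theta of pi satisfies
   theta(x, y) ~ pi(B) when x is in B and d(x, y) ~ r_n.  Quasisymmetry and, with
   the measure of mass m(B) on the branches through B, Ahlfors regularity
   follow.  That measure is the image of the Lebesgue measure of [0, 1[
   under a map that sends nested intervals of length m(B) into the cells. *)
From HB Require Import structures.
From Pilot Require Import Defs.
From mathcomp Require Import all_boot all_order all_algebra finmap.
From mathcomp Require Import all_classical all_reals all_analysis.
From mathcomp Require Import ring lra.
(* Imported again because the library shadows [center]. *)
Import Pilot.Defs.

Set Implicit Arguments.
Unset Strict Implicit.
Unset Printing Implicit Defensive.

Import Order.TTheory GRing.Theory Num.Theory.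
Import numFieldNormedType.Exports.

Local Open Scope classical_set_scope.
Local Open Scope ring_scope.

(** * Separated centers and the exponential kernel *)

(** The threshold may depend on [p], [lambda], [kappa], [KD] only, while [a] and [KP] are arbitrary.
    So the rate [s] is fixed first, from [kappa] and [KD], large enough that the kernel has mass at
    most 2 at every level and for every [a]. The scale [a] enters through the floor [eta] on the
    ratio child / parent, which may be tiny: it affects the constants of [theta], not the threshold.
    The kernel is exponential because K(x,y) K(y,z) <= K(x,z), so every kernel sum is Lipschitz with
    the rate of its kernel, and because a distance counts [a] times less at level [k] than at level
    [k.+1]: the variation of the old weight is paid by a small part of the new kernel, and [s] does
    not deteriorate along the levels. The crossing inequality omits the last cell of a path, since
    in the reduction of chains that cell opens the next run and must not be paid twice. The
    hypothesis on sigma counts it, so each cell is made to pay for its successor too; this is the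
    origin of [2 ^ p] in [A]. *)

Section covering_geometry.
Context {R : realType} {X : metricType R} {kappa a : R}.
Variable S : covering_system X kappa a.
Hypothesis kappa1 : 1 <= kappa.
Hypothesis a2 : 2 <= a.

Let a0 : 0 < a. Proof. by move: a2; lra. Qed.
Let kappa0 : 0 < kappa. Proof. by move: kappa1; lra. Qed.

Lemma level_coverP n x : exists B : S n, val B x.
Proof.
have : [set: X] x by [].
by rewrite -(level_cover S n) => -[B _ Bx]; exists B.
Qed.

Lemma mdist_center_mem n (B : S n) x : val B x ->
  mdist (center B) x < kappa * a ^- n.
Proof. by move=> /center_outer; rewrite ballEmdist. Qed.

Lemma center_separated n (B B' : S n) : B != B' ->
  kappa^-1 * a ^- n <= mdist (center B) (center B').
Proof.
move=> BB'; rewrite leNgt; apply/negP => lt.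
have := inner_disjoint BB'; rewrite -subset0 => /(_ (center B')); apply; split.
  by rewrite ballEmdist.
by rewrite ballEmdist/= mdistxx mulr_gt0// ?invr_gt0// exprn_gt0.
Qed.

Lemma voronoi_mdist_le n (B C : S n) y : voronoi B y ->
  mdist y (center B) <= mdist y (center C).
Proof.
rewrite /voronoi/= => ->; apply: ge_inf; last by exists C.
by exists 0 => _ [D _ <-]; exact: mdist_ge0.
Qed.

Lemma voronoi_near n (B : S n) y : voronoi B y ->
  mdist y (center B) < kappa * a ^- n.
Proof.
move=> yB; have [C Cy] := level_coverP n y.
apply: (le_lt_trans (voronoi_mdist_le C yB)).
by rewrite metric_sym mdist_center_mem.
Qed.

(** Doubling halves the radius [j] times, down to half the separation of the centers, where a ball
    holds at most one of them. *)
Lemma card_centers_le (KD : R) n j (x : X) (P : pred (S n)) :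
  1 <= KD -> doubling X KD ->
  (forall B, P B -> mdist x (center B) < 2 ^+ j * (kappa^-1 * a ^- n / 2)) ->
  #|P|%:R <= KD ^+ j.
Proof.
move=> KD1 dbl; have rho0 : 0 < kappa^-1 * a ^- n / 2.
  by rewrite divr_gt0// mulr_gt0 ?invr_gt0// exprn_gt0.
elim: j x P => [|j IH] x P HP.
  rewrite expr0 (_ : 1 = 1%:R)// ler_nat; apply/card_le1_eqP => B B' PB PB'.
  apply/eqP/negPn/negP => BB'; have := center_separated BB'.
  have := metric_triangle (center B') x (center B).
  have := HP _ PB; have := HP _ PB'; rewrite expr0 !mul1r (metric_sym _ x); lra.
have [|s ssz cov] := dbl x (2 ^+ j.+1 * (kappa^-1 * a ^- n / 2)).
  by rewrite mulr_gt0// exprn_gt0.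
pose Q y := [pred B | P B & mdist y (center B) < 2 ^+ j * (kappa^-1 * a ^- n / 2)].
have QP y : #|Q y|%:R <= KD ^+ j by apply: (IH y) => B /andP[].
apply: (@le_trans _ _ (\sum_(y <- s) #|Q y|%:R)); last first.
  rewrite exprS; apply: (@le_trans _ _ (\sum_(y <- s) KD ^+ j)).
    by apply: ler_sum => y _.
  rewrite big_const_seq count_predT iter_addr addr0 -mulr_natl.
  by rewrite ler_wpM2r// exprn_ge0// (le_trans ler01).
rewrite -natr_sum ler_nat.
under eq_bigr do rewrite -sum1_card.
rewrite -sum1_card (exchange_big_dep P)/=; last by move=> y B _ /andP[].
apply: leq_sum => B PB.
have : ball x (2 ^+ j.+1 * (kappa^-1 * a ^- n / 2)) (center B).
  by rewrite ballEmdist/=; exact: HP.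
move=> /cov[y /= ys]; rewrite ballEmdist/= exprS -!mulrA => yB.
rewrite (big_rem y)//= ifT ?ltn0Sn//; apply/andP; split => //.
move: yB; rewrite (_ : 2 * _ = 2 ^+ j * (kappa^-1 * a ^- n / 2))//.
by field; rewrite !gt_eqF// exprn_gt0.
Qed.

Definition expker (s : R) n (x y : X) : R := expR (- (s * (mdist x y * a ^+ n))).

(** Dyadic layers: layer [j] holds at most [KD ^ j] centers, and the kernel there is at most [q ^ j]
    because the distance grows like [2 ^ j], faster than [j]. Since [KD * q <= 1/2], a geometric
    series of sum 2 bounds the whole. *)
Lemma expker_sum_le (KD s : R) n (x : X) : 0 <= s -> 1 <= KD -> doubling X KD ->
  KD * expR (- (s / (4 * kappa))) <= 2^-1 ->
  \sum_(B : S n) expker s n x (center B) <= 2.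
Proof.
move=> s0 KD1 dbl sKD; set q := expR _ in sKD.
have q0 : 0 < q by exact: expR_gt0.
have an0 : 0 < a ^+ n by rewrite exprn_gt0.
pose t (B : S n) : R := mdist x (center B) * a ^+ n.
have t0 B : 0 <= t B by rewrite mulr_ge0 ?mdist_ge0// ltW.
have ex B : exists j : nat,
    (t B < 2 ^+ j / (2 * kappa)) && (expR (- (s * t B)) <= q ^+ j).
  have exj : exists j, t B < 2 ^+ j / (2 * kappa).
    exists (Num.trunc (t B * (2 * kappa))).+1.
    rewrite ltr_pdivlMr ?mulr_gt0//.
    apply: lt_le_trans (truncnS_gt _) _.
    by rewrite -natrX ler_nat ltnW// ltn_expl.
  case: (ex_minnP exj) => -[|j] jt jmin.
    exists 0%N; rewrite jt expr0 -expR0 ler_expR oppr_le0 mulr_ge0//.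
  exists j.+1; rewrite jt/= /q -expRM_natl ler_expR mulrN lerN2.
  have : 2 ^+ j / (2 * kappa) <= t B.
    by rewrite leNgt; apply/negP => /jmin; rewrite ltnn.
  move=> jt'; have -> : j.+1%:R * (s / (4 * kappa)) = s * (j.+1%:R / (4 * kappa)).
    by ring.
  rewrite ler_wpM2l// (le_trans _ jt')// ler_pdivrMr ?mulr_gt0//.
  have -> : 2 ^+ j / (2 * kappa) * (4 * kappa) = 2 ^+ j * 2 by field; rewrite gt_eqF.
  have : j.+1%:R <= 2 ^+ j :> R by rewrite -natrX ler_nat ltn_expl.
  have : 0 <= 2 ^+ j :> R by rewrite exprn_ge0.
  lra.
have [j jP] := choice ex.
pose close (i : nat) B := t B < 2 ^+ i / (2 * kappa).
pose N := (\max_(B : S n) j B).+1.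
(* Each cell is counted in every layer [i] with [close i B], not only in its own: after the exchange
   of sums only balls have to be counted, not annuli. *)
apply: (@le_trans _ _ (\sum_(B : S n) \sum_(i < N | close i B) q ^+ i)).
  apply: ler_sum => B _; have /andP[jB1 jB2] := jP B.
  have jN : (j B < N)%N by rewrite ltnS; exact: leq_bigmax.
  rewrite (bigD1 (Ordinal jN))//= -[leLHS]addr0 lerD// ?sumr_ge0// => i _.
  by rewrite exprn_ge0// ltW.
rewrite (exchange_big_dep predT)//.
apply: (@le_trans _ _ (\sum_(i < N) (2^-1 : R) ^+ i)).
  apply: ler_sum => i _; rewrite sumr_const.
  apply: (@le_trans _ _ ((KD * q) ^+ i)); last first.
    by rewrite lerXn2r// nnegrE// ?invr_ge0// mulr_ge0// ?(ltW q0)// (le_trans ler01).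
  rewrite exprMn -[leLHS]mulr_natl ler_wpM2r ?exprn_ge0 ?(ltW q0)//.
  apply: (@card_centers_le KD n i x (close i)) => // B.
  rewrite /close /t => tB; rewrite -(ltr_pM2r an0) (lt_le_trans tB)// le_eqVlt.
  by apply/orP; left; apply/eqP; field; rewrite !gt_eqF.
have : (1 - 2^-1 : R) * \sum_(i < N) 2^-1 ^+ i <= 1.
  by rewrite -opprB mulNr -subrX1 opprB gerBl exprn_ge0// invr_ge0.
lra.
Qed.

End covering_geometry.

(** * Weights *)

Lemma continuous_sum (R : realType) (I : finType) (P : pred I) (F : I -> R -> R) :
  (forall i, continuous (F i)) -> continuous (fun c => \sum_(i | P i) F i c).
Proof.
move=> Fc x; elim: (index_enum I) => [|i r IH].
  rewrite (_ : (fun c => _) = cst 0); first exact: cst_continuous.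
  by apply/funext => c; rewrite big_nil.
rewrite (_ : (fun c => _) =
    (fun c => (if P i then F i c else 0) + \sum_(j <- r | P j) F j c)).
  apply: continuousD => //; case: (P i); [exact: Fc|exact: cst_continuous].
by apply/funext => c; rewrite big_cons; case: (P i); rewrite // add0r.
Qed.

Section expker_theory.
Context {R : realType} {X : metricType R} {a : R}.
Implicit Types x y z : X.

Local Notation K := (@expker R X a).
Hypothesis a1 : 1 <= a.


Lemma expker_gt0 s n x y : 0 < K s n x y.
Proof. exact: expR_gt0. Qed.

Lemma expker_ge0 s n x y : 0 <= K s n x y.
Proof. exact: expR_ge0. Qed.

Lemma expker_sym s n x y : K s n x y = K s n y x.
Proof. by rewrite /expker metric_sym. Qed.

Lemma expkerxx s n x : K s n x x = 1.
Proof. by rewrite /expker mdistxx mul0r mulr0 oppr0 expR0. Qed.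

Lemma expker_trans s n y x z : 0 <= s ->
  K s n x y * K s n y z <= K s n x z.
Proof.
move=> s0; rewrite /expker -expRD ler_expR -opprD lerN2 -mulrDr ler_wpM2l//.
rewrite -mulrDl ler_wpM2r ?exprn_ge0 ?metric_triangle//.
by rewrite (le_trans ler01).
Qed.

Lemma expker_ge s n x y t : 0 <= s -> mdist x y <= t * a ^- n ->
  expR (- (s * t)) <= K s n x y.
Proof.
move=> s0 xyt; rewrite /expker ler_expR lerN2 ler_wpM2l//.
by rewrite -ler_pdivlMr// exprn_gt0// (lt_le_trans ltr01).
Qed.

Lemma expker_scale s n x y : 0 <= s -> 2 <= a ->
  K s n.+1 x y <= K (2 * s) n x y.
Proof.
move=> s0 a2; rewrite /expker ler_expR lerN2 exprS.
rewrite [leLHS](_ : _ = s * mdist x y * a ^+ n * 2); last by ring.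
rewrite [leRHS](_ : _ = s * mdist x y * a ^+ n * a); last by ring.
rewrite ler_wpM2l// !mulr_ge0// ?mdist_ge0// exprn_ge0//.
exact: le_trans a1.
Qed.

End expker_theory.

(** * One step of the construction: from weights of level k to weights of level k+1 *)

Section weight_step.
Context {R : realType} {X : metricType R} {kappa a : R}.
Variable S : covering_system X kappa a.
Variable parent : forall n, S n.+1 -> S n.
Variables (p lambda KD s1 : R).
Hypothesis lambda32 : 32 <= lambda.
Hypothesis kappa1 : 1 <= kappa.
Hypothesis KD1 : 1 <= KD.
Hypothesis dbl : doubling X KD.
Hypothesis a_ge : 192 * kappa ^+ 2 <= a.
Hypothesis par : is_parent parent.
Hypothesis s1_ge : 4 <= s1.
Hypothesis s1_KD : KD * expR (- (s1 / (4 * kappa))) <= 2^-1.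

(** The factor [16 * kappa ^ 2] makes [s * a / (4 * kappa) = 4 * kappa * s1 * a], so that [eta]
    beats the number of children of a cell. The exponent of [eta] is half the decay, in units of
    level [k.+1], between the center of a cell and a non-child. In [A], the exponentials undo the
    kernel between two neighbors (distance [2 * lambda * kappa] in units of level [k.+1]) and the
    variation of [m] over the distance [4 * kappa] in units of level [k]. *)
Let s := 16 * kappa ^+ 2 * s1.
Let eta := expR (- (s * a / (4 * kappa))).
Let A := 2 `^ p * expR (s * (2 * lambda * kappa)) * expR (s * (4 * kappa)).


Local Notation K := (@expker R X a).

Definition lipschitz_weight n (m : S n -> R) :=
  forall B B' : S n, K s n (center B) (center B') * m B <= m B'.

Let kk1 : 1 <= kappa ^+ 2. Proof. by rewrite exprn_ege1. Qed.
Let a192 : 192 <= a.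
Proof. by apply: le_trans a_ge; rewrite ler_peMr. Qed.
Let a0 : 0 < a. Proof. by move: a192; lra. Qed.
Let a1 : 1 <= a. Proof. by move: a192; lra. Qed.
Let a2 : 2 <= a. Proof. by move: a192; lra. Qed.
Let k0 : 0 < kappa. Proof. by move: kappa1; lra. Qed.
Let s10 : 0 < s1. Proof. by move: s1_ge; lra. Qed.
Let s0 : 0 < s.
Proof. by rewrite /s !mulr_gt0// exprn_gt0. Qed.
Let s1s : 2 * s1 <= s.
Proof. by rewrite /s ler_wpM2r// ?ltW//; move: kk1; lra. Qed.
Let an0 n : 0 < a ^+ n. Proof. by rewrite exprn_gt0. Qed.
Let eta0 : 0 < eta. Proof. exact: expR_gt0. Qed.

Let expker_sum t n x : s1 <= t -> \sum_(B : S n) K t n x (center B) <= 2.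
Proof.
move=> st; apply: (@expker_sum_le _ _ _ _ _ kappa1 a2 KD) => //.
  by rewrite (le_trans _ st)// ltW.
apply: le_trans s1_KD; rewrite ler_wpM2l ?(le_trans ler01)// ler_expR lerN2.
by rewrite ler_wpM2r// invr_ge0 mulr_ge0// ltW.
Qed.

Let parent_near n (B : S n.+1) :
  mdist (center B) (center (parent B)) <= kappa * a ^- n.
Proof. by rewrite ltW// voronoi_near//; exact: par. Qed.

Section step.
Variable k : nat.
Variable m : S k -> R.
Variable sigma : S k.+1 -> R.
Variable eps0 : R.
Hypothesis m_gt0 : forall B, 0 < m B.
Hypothesis m_lip : lipschitz_weight m.
Hypothesis sigma0 : forall B, 0 <= sigma B.
Hypothesis sigma_sum :
  forall B : S k, \sum_(B' : S k.+1 | parent B' == B) sigma B' `^ p <= eps0.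
Hypothesis eps0_le : A * expR (s * (4 * kappa)) * 4 * eps0 <= 4^-1.

(* The three ingredients of the new weight.  [smooth_weight] carries sigma;
   [floor_weight] bounds the ratio child / parent below and dominates, outside
   the children of [D], the weight [c * m D * exp(- s d)] added around the
   center of [D] in [weight_step] to make the children add up to [m D]. *)
Definition smooth_weight (B' : S k.+1) :=
  A * \sum_(E' : S k.+1) K s k.+1 (center B') (center E') *
      (sigma E' `^ p * m (parent E')).

Definition floor_weight (B' : S k.+1) :=
  eta * \sum_(C : S k) K (2 * s) k (center B') (center C) * m C.

Definition base_weight B' := smooth_weight B' + floor_weight B'.

Let A0 : 0 < A.
Proof. by rewrite !mulr_gt0// ?expR_gt0// powR_gt0. Qed.

Lemma smooth_weight_ge0 B' : 0 <= smooth_weight B'.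
Proof.
rewrite mulr_ge0 ?(ltW A0)// sumr_ge0// => E' _.
by rewrite mulr_ge0 ?expker_ge0// mulr_ge0 ?powR_ge0// ltW.
Qed.

Lemma floor_weight_ge B' : eta * expR (- (2 * s * kappa)) * m (parent B') <= floor_weight B'.
Proof.
rewrite -mulrA ler_wpM2l ?(ltW eta0)// (bigD1 (parent B'))//=.
rewrite ler_wpDr//; last first.
  rewrite ler_wpM2r ?(ltW (m_gt0 _))//; apply: (expker_ge a1).
    by rewrite mulr_ge0// ltW.
  exact: parent_near.
by rewrite sumr_ge0// => C _; rewrite mulr_ge0 ?expker_ge0// ltW.
Qed.

Lemma floor_weight_gt0 B' : 0 < floor_weight B'.
Proof.
apply: lt_le_trans (floor_weight_ge B').
by rewrite !mulr_gt0// ?expR_gt0.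
Qed.

Lemma base_weight_gt0 B' : 0 < base_weight B'.
Proof. by rewrite ltr_wpDl ?smooth_weight_ge0 ?floor_weight_gt0. Qed.

(** Both parts are kernel sums. The kernel of the floor has rate [2 * s] at level [k], which is
    still flatter than rate [s] at level [k.+1] as [2 <= a]. *)
Lemma base_weight_lipschitz B' F' : K s k.+1 (center B') (center F') * base_weight B' <=
  base_weight F'.
Proof.
rewrite mulrDr lerD//.
  rewrite mulrCA ler_wpM2l ?(ltW A0)// mulr_sumr ler_sum// => E' _.
  rewrite [leLHS]mulrA ler_wpM2r// ?mulr_ge0 ?powR_ge0 ?(ltW (m_gt0 _))//.
  by rewrite expker_sym expker_trans// ltW.
rewrite mulrCA ler_wpM2l ?(ltW eta0)// mulr_sumr ler_sum// => C _.
rewrite [leLHS]mulrA ler_wpM2r// ?(ltW (m_gt0 _))//.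
apply: (le_trans _ (expker_trans a1 k (center B') (center F') (center C)
  (mulr_ge0 (ler0n _ 2) (ltW s0)))).
by rewrite ler_wpM2r ?expker_ge0// expker_sym expker_scale// ltW.
Qed.

(* The distance of the parents is at most that of the children plus 2 kappa r_k,
   and the unit of level [k.+1] is at least 192 times smaller: half of the
   kernel of level [k.+1] pays for two kernels of level [k]. *)
Lemma smooth_weight_exchange (B : S k) (E' B' : S k.+1) : parent B' = B ->
  K s k.+1 (center B') (center E') * m (parent E') <=
  expR (s * (4 * kappa)) * K (s / 2) k.+1 (center B') (center E') *
    K s k (center B) (center (parent E')) * m B.
Proof.
move=> BB'; set D := parent E'.
have mD : K s k (center D) (center B) * m D <= m B.
  exact: m_lip.
have KD0 := expker_gt0 (a := a) s k (center D) (center B).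
rewrite -(ler_pM2l KD0) mulrCA.
apply: (le_trans (ler_wpM2l (expker_ge0 _ _ _ _) mD)).
rewrite [leRHS]mulrA ler_wpM2r ?(ltW (m_gt0 _))//.
rewrite [K s k (center B) _]expker_sym /expker -!expRD ler_expR.
have t1 := metric_triangle (center D) (center B') (center B).
have t2 := metric_triangle (center D) (center E') (center B').
have p1 := parent_near B'; rewrite BB' in p1.
have p2 := parent_near E'; rewrite -/D metric_sym in p2.
set x := mdist (center D) _ in t1 *; set y := mdist (center B') _.
rewrite (metric_sym (center E')) -/y in t2.
have xy : x * a ^+ k <= 2 * kappa + y * a ^+ k.
  have : x <= 2 * kappa * a ^- k + y by lra.
  by rewrite -(ler_pM2r (an0 k)) mulrDl mulfVK ?gt_eqF.
have y0 : 0 <= y by exact: mdist_ge0.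
have yk : 192 * (y * a ^+ k) <= y * a ^+ k.+1.
  by rewrite exprS [leRHS]mulrCA ler_wpM2r// mulr_ge0// ltW.
set z := y * a ^+ k.+1 in yk *.
have y1 : 0 <= y * a ^+ k by rewrite mulr_ge0// ltW.
rewrite -subr_ge0.
have h : 0 <= 4 * kappa + z / 2 - 2 * (x * a ^+ k) by lra.
rewrite [leRHS](_ : _ = s * (4 * kappa + z / 2 - 2 * (x * a ^+ k))).
  by rewrite mulr_ge0// ltW.
by rewrite /z; field.
Qed.

(** After exchanging the sums, the remaining half kernel sums over [B'] to at most 2, the children
    of each [D] give [eps0], and the kernel of level [k] sums over [D] to at most 2. The product of
    these factors is the left side of [eps0_le]. *)
Lemma smooth_weight_sum_le (B : S k) :
  \sum_(B' : S k.+1 | parent B' == B) smooth_weight B' <= m B / 4.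
Proof.
set e4 := expR (s * (4 * kappa)).
have e40 : 0 < e4 by exact: expR_gt0.
have eps00 : 0 <= eps0.
  by apply: le_trans (sigma_sum B); rewrite sumr_ge0// => E' _; exact: powR_ge0.
have mB := m_gt0 B.
have e4mB : 0 <= e4 * m B by rewrite mulr_ge0 ?(ltW e40) ?(ltW mB).
rewrite -mulr_sumr.
apply: (@le_trans _ _ (A * (e4 * m B * (\sum_(E' : S k.+1)
    sigma E' `^ p * K s k (center B) (center (parent E')) * 2)))).
  rewrite ler_wpM2l ?(ltW A0)// exchange_big/= mulr_sumr ler_sum// => E' _.
  apply: (@le_trans _ _ (\sum_(B' | parent B' == B) e4 * m B * (sigma E' `^ p *
      K s k (center B) (center (parent E')) * K (s / 2) k.+1 (center E') (center B')))).
    apply: ler_sum => B' /eqP B'B; rewrite mulrCA.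
    apply: (le_trans (ler_wpM2l (powR_ge0 _ _) (smooth_weight_exchange E' B'B))).
    rewrite le_eqVlt; apply/orP; left; apply/eqP.
    by rewrite (expker_sym _ _ (center B')) -/e4; ring.
  rewrite -mulr_sumr ler_wpM2l//.
  rewrite -mulr_sumr ler_wpM2l ?mulr_ge0 ?powR_ge0 ?expker_ge0//.
  apply: (@le_trans _ _ (\sum_(B' : S k.+1) K (s / 2) k.+1 (center E') (center B'))).
    rewrite [leRHS](bigID (fun B' => parent B' == B))/= lerDl sumr_ge0// => ? _.
    exact: expker_ge0.
  by apply: expker_sum; move: s1s; lra.
rewrite (partition_big (@parent k) predT)//=.
apply: (@le_trans _ _ (A * (e4 * m B *
    \sum_(D : S k) K s k (center B) (center D) * (2 * eps0)))).
  rewrite ler_wpM2l ?(ltW A0)// ler_wpM2l// ler_sum// => D _.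
  apply: (@le_trans _ _ (\sum_(E' | parent E' == D)
      (K s k (center B) (center D) * 2) * sigma E' `^ p)).
    rewrite le_eqVlt; apply/orP; left; apply/eqP.
    by apply: eq_bigr => E' /eqP ->; ring.
  by rewrite -mulr_sumr [leRHS]mulrA ler_wpM2l ?mulr_ge0 ?expker_ge0.
rewrite -mulr_suml.
have := expker_sum k (center B) (le_trans (_ : s1 <= 2 * s1) s1s).
rewrite ler_peMl ?(ltW s10)// ?ler1n// => /(_ isT) sum2.
have : A * (e4 * m B * ((\sum_(C : S k) K s k (center B) (center C)) * (2 * eps0))) <=
  A * (e4 * m B * (2 * (2 * eps0))).
  rewrite ler_wpM2l ?(ltW A0)// ler_wpM2l// ler_wpM2r// mulr_ge0//.
move=> /le_trans; apply.
rewrite (_ : A * _ = m B * (A * e4 * 4 * eps0)); last by ring.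
by rewrite ler_wpM2l ?(ltW mB).
Qed.

Lemma eta_small : 4 * (eta * expR (s * kappa + s1 * kappa * a)) <= 4^-1.
Proof.
set w := kappa * s1 * a.
have w768 : 768 <= w.
  have : 1 * 4 * 192 <= w by rewrite /w !ler_pM// mulr_ge0// ltW.
  lra.
have e1 : s * a / (4 * kappa) = 4 * w by rewrite /s /w; field; rewrite gt_eqF.
have e2 : s * kappa <= w.
  rewrite /s /w (_ : _ * kappa = kappa * s1 * (16 * kappa ^+ 2)); last by ring.
  rewrite ler_wpM2l ?mulr_ge0 ?ltW//.
  by move: a_ge (exprn_gt0 2 k0); lra.
rewrite /eta e1 -expRD.
apply: (@le_trans _ _ (4 * expR (- w))).
  have e3 : s1 * kappa * a = w by rewrite /w; ring.
  by rewrite ler_wpM2l// ler_expR e3; lra.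
rewrite expRN -ler_pdivlMl// -[leRHS]invfM lef_pV2 ?posrE ?expR_gt0//.
by have := expR_ge1Dx w; lra.
Qed.

(** Half of the rate [2 * s] absorbs the variation of [m] and the other half is summed, so each
    child has floor weight at most [2 * eta * exp(s * kappa) * m B]. There are at most
    [2 * exp(s1 * kappa * a)] children: each lies within [kappa * a] units of level [k.+1] from the
    center of [B], and the kernel of rate [s1] has mass at most 2. Then [eta_small] applies. *)
Lemma floor_weight_sum_le (B : S k) :
  \sum_(B' : S k.+1 | parent B' == B) floor_weight B' <= m B / 4.
Proof.
have mB := m_gt0 B.
have fl B' : parent B' = B -> floor_weight B' <= 2 * (eta * expR (s * kappa) * m B).
  move=> B'B; have e0 : 0 < expR (- (s * kappa)) by exact: expR_gt0.
  rewrite -(ler_pM2l e0) [leRHS](_ : _ = eta * (m B * 2)); last first.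
    by rewrite expRN; field; rewrite gt_eqF// expR_gt0.
  rewrite mulrCA ler_wpM2l ?(ltW eta0)//.
  apply: (@le_trans _ _ (\sum_(C : S k) m B * K s k (center B') (center C))).
    rewrite mulr_sumr ler_sum// => C _.
    have -> : K (2 * s) k (center B') (center C) =
        K s k (center B') (center C) * K s k (center B') (center C).
      by rewrite /expker -expRD; congr expR; ring.
    set c := K s k _ _; rewrite [leLHS](_ : _ = c * (expR (- (s * kappa)) * (c * m C)));
      last by ring.
    rewrite [leRHS]mulrC ler_wpM2l ?expker_ge0//.
    apply: le_trans (m_lip C B); rewrite [leLHS]mulrA ler_wpM2r ?(ltW (m_gt0 _))//.
    apply: (le_trans _ (expker_trans a1 k (center B') (center C) (center B) (ltW s0))).
    rewrite mulrC expker_sym ler_wpM2l ?expker_ge0//.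
    by apply: (expker_ge a1 (ltW s0)); rewrite -B'B parent_near.
  rewrite -mulr_sumr ler_wpM2l ?(ltW mB)// expker_sum//.
  by move: s1s s10; lra.
have := expker_sum k.+1 (center B) (lexx s1).
rewrite (bigID (fun B' => parent B' == B))/= => sum2.
have {sum2} : \sum_(B' : S k.+1 | parent B' == B) expR (- (s1 * (kappa * a))) <= 2.
  apply: le_trans sum2; rewrite -[leLHS]addr0 lerD//; last first.
    by rewrite sumr_ge0// => *; exact: expker_ge0.
  apply: ler_sum => B' /eqP B'B; apply: (expker_ge a1 (ltW s10)).
  rewrite metric_sym -B'B (le_trans (parent_near _))// exprS invfM mulrA.
  by rewrite mulfK// gt_eqF.
rewrite big_const iter_addr addr0 => card.
apply: (@le_trans _ _ (\sum_(B' : S k.+1 | parent B' == B)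
    2 * (eta * expR (s * kappa) * m B))).
  by apply: ler_sum => B' /eqP; exact: fl.
rewrite big_const iter_addr addr0.
set N := #|_| in card *.
have e1 : expR (- (s1 * (kappa * a))) * expR (s * kappa + s1 * kappa * a) = expR (s * kappa).
  by rewrite -expRD; congr expR; ring.
rewrite -e1; set e := expR (- _) in card *; set f := expR (_ + _) in e1 *.
have f0 : 0 <= eta * f by rewrite mulr_ge0 ?(ltW eta0)// expR_ge0.
apply: (@le_trans _ _ (2 * (eta * f) * m B * (e *+ N))).
  rewrite le_eqVlt; apply/orP; left; apply/eqP.
  by rewrite -[in LHS]mulr_natl -[in RHS]mulr_natl; ring.
apply: (@le_trans _ _ (2 * (eta * f) * m B * 2)).
  by rewrite ler_wpM2l// !mulr_ge0// ?(ltW eta0)// ?(ltW mB)// expR_ge0.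
rewrite (_ : _ * 2 = m B * (4 * (eta * f))); last by ring.
by rewrite ler_wpM2l ?(ltW mB)// eta_small.
Qed.

Let center_sep_half (D : S k) (E' : S k.+1) : parent E' != D ->
  kappa^-1 * a ^- k / 2 <= mdist (center E') (center D).
Proof.
move=> ED; have := center_separated kappa1 a2 ED.
have := voronoi_mdist_le D (par E').
have := metric_triangle (center (parent E')) (center E') (center D).
rewrite (metric_sym (center (parent E')) (center E')); lra.
Qed.

Lemma parent_of_close (D : S k) (E' : S k.+1) :
  mdist (center E') (center D) < kappa^-1 * a ^- k / 2 -> parent E' = D.
Proof.
by move=> lt; apply/eqP/negPn/negP => /center_sep_half; rewrite leNgt lt.
Qed.

(** A non-child of [D] is at least [a / (2 * kappa)] units of level [k.+1] away from the center of
    [D]. Half of this distance pays for [eta]; the other half pays for the offset of [B0] and for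
    the kernel of level [k]. So weight added near the center of [D] is already below the floor once
    the children of [D] are left. *)
Lemma raise_le_floor_weight (D : S k) (B0 B' : S k.+1) : val B0 (center D) ->
  parent B' != D -> m D * K s k.+1 (center B0) (center B') <= floor_weight B'.
Proof.
move=> B0D B'D.
apply: (@le_trans _ _ (eta * (K (2 * s) k (center B') (center D) * m D))); last first.
  rewrite ler_wpM2l ?(ltW eta0)// (bigD1 D)//= lerDl sumr_ge0// => C _.
  by rewrite mulr_ge0 ?expker_ge0// ltW.
rewrite mulrC mulrA ler_wpM2r ?(ltW (m_gt0 _))// /eta /expker -expRD ler_expR.
have := mdist_center_mem B0D; set x := mdist _ (center D) => xlt.
have t1 := metric_triangle (center B') (center B0) (center D).
have y_ge := center_sep_half B'D.
set y := mdist (center B') (center D) in t1 y_ge *.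
have {}xlt : x * a ^+ k.+1 <= kappa by rewrite -ler_pdivlMr// ltW.
rewrite (metric_sym (center B') (center B0)) -/x in t1.
set z := mdist (center B0) (center B') in t1 *.
have {}t1 : y * a ^+ k.+1 - x * a ^+ k.+1 <= z * a ^+ k.+1.
  by rewrite -mulrBl ler_wpM2r ?(ltW (an0 _))//; lra.
set u := y * a ^+ k.+1 in t1; set v := y * a ^+ k.
have v_ge : (2 * kappa)^-1 <= v.
  rewrite /v -ler_pdivrMr// (le_trans _ y_ge)// invfM.
  by rewrite le_eqVlt; apply/orP; left; apply/eqP; ring.
have uv : u = a * v by rewrite /u /v exprS; ring.
have h1 : a / (2 * kappa) <= u by rewrite uv ler_wpM2l// ltW.
have h2 : 192 * v <= u.
  by rewrite uv ler_wpM2r//; apply: le_trans v_ge; rewrite invr_ge0 mulr_ge0// ltW.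
have h3 : 96 * kappa <= u.
  apply: le_trans h1; rewrite ler_pdivlMr ?mulr_gt0//.
  by apply: le_trans a_ge; rewrite le_eqVlt; apply/orP; left; apply/eqP; ring.
rewrite (_ : a / (2 * kappa) = 2 * (a / (4 * kappa))) in h1; last first.
  by field; rewrite gt_eqF.
rewrite -subr_ge0.
have h : 0 <= z * a ^+ k.+1 - a / (4 * kappa) - 2 * v by move: k0; lra.
rewrite [leRHS](_ : _ = s * (z * a ^+ k.+1 - a / (4 * kappa) - 2 * v)).
  by rewrite mulr_ge0// ltW.
by rewrite /v; ring.
Qed.

Lemma base_weight_sum_le (B : S k) :
  \sum_(B' : S k.+1 | parent B' == B) base_weight B' <= m B / 2.
Proof.
rewrite big_split/=; have := smooth_weight_sum_le B; have := floor_weight_sum_le B; lra.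
Qed.

Lemma base_weight_ge_sigma (B' F' : S k.+1) (C : S k) :
  mdist (center B') (center F') <= 2 * lambda * kappa * a ^- k.+1 ->
  mdist (center C) (center F') <= 3 * kappa * a ^- k ->
  (2 * sigma F') `^ p * m C <= base_weight B'.
Proof.
move=> BF CF; apply: (@le_trans _ _ (smooth_weight B')); last first.
  by rewrite lerDl ltW ?floor_weight_gt0.
rewrite /smooth_weight (bigD1 F')//= mulrDr ler_wpDr//.
  rewrite mulr_ge0 ?(ltW A0)// sumr_ge0// => E' _.
  by rewrite mulr_ge0 ?expker_ge0// mulr_ge0 ?powR_ge0// ltW.
rewrite powRM// /A.
have l0 : 0 < lambda by move: lambda32; lra.
have k1 : expR (- (s * (2 * lambda * kappa))) <= K s k.+1 (center B') (center F').
  by apply: (expker_ge a1 (ltW s0)).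
have k2 : expR (- (s * (4 * kappa))) * m C <= m (parent F').
  apply: le_trans (m_lip C (parent F')); rewrite ler_wpM2r ?(ltW (m_gt0 _))//.
  apply: (expker_ge a1 (ltW s0)).
  have := parent_near F'; have := metric_triangle (center C) (center F') (center (parent F')).
  lra.
set e := expR _ in k1; set f := expR _ in k2.
have e0 : 0 < e by exact: expR_gt0.
have f0 : 0 < f by exact: expR_gt0.
have -> : expR (s * (2 * lambda * kappa)) = e^-1 by rewrite /e expRN invrK.
have -> : expR (s * (4 * kappa)) = f^-1 by rewrite /f expRN invrK.
rewrite [leLHS](_ : _ = 2 `^ p / e / f * (e * (sigma F' `^ p * (f * m C)))); last first.
  by field; rewrite !gt_eqF.
rewrite ler_wpM2l//; first by rewrite !mulr_ge0 ?powR_ge0 ?invr_ge0// ltW.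
rewrite ler_pM ?(ltW e0)//; first by rewrite !mulr_ge0 ?powR_ge0// ltW.
by rewrite ler_wpM2l ?powR_ge0.
Qed.

(** The new weight is the maximum of the base weight and, on the children of each [D], a bump around
    the center of [D]. Inside one family of children both are Lipschitz; between two families the
    bump is dominated by the floor, by [raise_le_floor_weight]. *)
Lemma weight_step : exists m' : S k.+1 -> R,
  [/\ lipschitz_weight m',
      forall B', eta * expR (- (2 * s * kappa)) * m (parent B') <= m' B',
      forall B' F' C, mdist (center B') (center F') <= 2 * lambda * kappa * a ^- k.+1 ->
        mdist (center C) (center F') <= 3 * kappa * a ^- k ->
        (2 * sigma F') `^ p * m C <= m' B'
    & forall B, \sum_(B' : S k.+1 | parent B' == B) m' B' = m B].
Proof.
have [B0 B0P] : exists B0 : S k -> S k.+1, forall D, val (B0 D) (center D).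
  have [f fP] := choice (fun D : S k => level_coverP S k.+1 (center D)).
  by exists f.
pose g (c : R) D B' :=
  Num.max (base_weight B') (c * (m D * K s k.+1 (center (B0 D)) (center B'))).
have parB0 D : parent (B0 D) = D.
  apply: parent_of_close; apply: (lt_le_trans (mdist_center_mem (B0P D))).
  rewrite exprS invfM mulrA [leRHS]mulrAC ler_wpM2r ?invr_ge0 ?(ltW (an0 _))//.
  rewrite ler_pdivrMr// [leLHS](_ : _ = kappa^-1 / 2 * (2 * kappa ^+ 2)).
    rewrite ler_wpM2l ?divr_ge0 ?invr_ge0 ?(ltW k0)//.
    by move: a_ge kk1; lra.
  by field; rewrite gt_eqF.
(* [c D] is found by the intermediate value theorem. *)
have [c cP] : exists c : S k -> R, forall D, (0 <= c D <= 1) /\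
    \sum_(B' : S k.+1 | parent B' == D) g (c D) D B' = m D.
  suff ex D : exists c : R, (0 <= c <= 1) /\
      \sum_(B' : S k.+1 | parent B' == D) g c D B' = m D.
    by have [f fP] := choice ex; exists f.
  pose h c := \sum_(B' : S k.+1 | parent B' == D) g c D B'.
  have hc : continuous h.
    apply: continuous_sum => B' x; apply: (@continuous_max R R (cst _) (fun c => c * _)).
      exact: cst_continuous.
    by apply: continuousM; [exact: cvg_id|exact: cst_continuous].
  have [|||c] := @IVT _ h 0 1 (m D) => //.
  - by apply: continuous_subspaceT.
  (* At [c = 0] the children carry at most [m D / 2]; at [c = 1] the child [B0 D] alone carries
     [m D]. *)
  - rewrite ge_min le_max; apply/andP; split; apply/orP; [left|right].
      apply: le_trans (_ : _ <= m D / 2) _; last by have := m_gt0 D; lra.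
      apply: le_trans (base_weight_sum_le D); apply: ler_sum => B' _.
      by rewrite /g mul0r ge_max lexx ltW// base_weight_gt0.
    rewrite /h (bigD1 (B0 D)) ?parB0//= -[leLHS]addr0 lerD//.
      by rewrite /g mul1r expkerxx mulr1 le_max lexx orbT.
    by rewrite sumr_ge0// => B' _; rewrite le_max ltW// base_weight_gt0.
  - by rewrite in_itv/= => c01 hcm; exists c.
have c0 D : 0 <= c D by have [/andP[]] := cP D.
have c1 D : c D <= 1 by have [/andP[]] := cP D.
exists (fun B' => g (c (parent B')) (parent B') B'); split.
- move=> B' F'; rewrite /g maxr_pMr ?expker_ge0//.
  rewrite ge_max; apply/andP; split.
    by rewrite le_max base_weight_lipschitz.
  set D := parent B'.
  have le1 : K s k.+1 (center B') (center F') * (c D * (m D * K s k.+1 (center (B0 D)) (center B')))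
    <= c D * (m D * K s k.+1 (center (B0 D)) (center F')).
    rewrite mulrCA ler_wpM2l// mulrCA ler_wpM2l ?(ltW (m_gt0 _))//.
    by rewrite mulrC (expker_trans a1)// ltW.
  apply: (le_trans le1); have [<-|FD] := eqVneq (parent F') D.
    by rewrite le_max lexx orbT.
  rewrite le_max; apply/orP; left.
  apply: (@le_trans _ _ (floor_weight F')); last by rewrite lerDr smooth_weight_ge0.
  apply: (le_trans _ (raise_le_floor_weight (B0P D) FD)).
  by rewrite ler_piMl// mulr_ge0 ?expker_ge0// ltW.
- move=> B'; rewrite le_max; apply/orP; left.
  by apply: (le_trans (floor_weight_ge B')); rewrite lerDr smooth_weight_ge0.
- by move=> B' F' C BF CF; rewrite le_max base_weight_ge_sigma.
- move=> B; have [_ <-] := cP B.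
  by apply: eq_bigr => B' /eqP ->.
Qed.

End step.
End weight_step.

Lemma expVn_le_eps (R : realType) (a e : R) : 2 <= a -> 0 < e ->
  exists n0, forall n, (n0 <= n)%N -> a ^- n <= e.
Proof.
move=> a2 e0; exists (Num.trunc e^-1).+1 => n n0.
have a0 : 0 < a by apply: lt_le_trans a2.
rewrite -[leRHS]invrK lef_pV2 ?posrE ?invr_gt0 ?exprn_gt0//.
apply: (@le_trans _ _ n%:R).
  by apply: le_trans (ltW (truncnS_gt _)) _; rewrite ler_nat.
apply: (@le_trans _ _ (2 ^+ n)); first by rewrite -natrX ler_nat ltnW// ltn_expl.
by rewrite lerXn2r// nnegrE ltW.
Qed.

Lemma mdist_le_ediam (R : realType) (Y : metricType R) (A : set Y) x y :
  A x -> A y -> ((mdist x y)%:E <= ediam A)%E.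
Proof.
move=> Ax Ay; rewrite /ediam le_max; apply/orP; right.
by apply: ereal_sup_ubound; exists (x, y).
Qed.

(** [m] plays the role of the p-th power of the diameter in the new metric. Decay is asked only from
    level [k0] on, because a cell of size comparable to [X] may have a single child. In
    [weight_path] the cell [E] outside [2 . B] is not counted. *)
Record conformal_weight (R : realType) (X : metricType R) (kappa a : R)
    (S : covering_system X kappa a) (parent : forall n, S n.+1 -> S n)
    (p lambda s rho : R) (k0 : nat) (m : forall n, S n -> R) : Prop :=
  ConformalWeight {
    weight_root : forall B : S 0%N, m 0%N B = 1;
    weight_lip : forall n (B B' : S n),
      @expker R X a s n (center B) (center B') * m n B <= m n B';
    weight_ge : forall n (B : S n.+1), rho * m n (parent n B) <= m n.+1 B;
    weight_decay : forall n (B : S n.+1), (k0 <= n)%N ->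
      m n.+1 B <= (1 - rho) * m n (parent n B);
    weight_sum : forall n (B : S n),
      \sum_(B' : S n.+1 | parent n B' == B) m n.+1 B' = m n B;
    weight_path : forall n (B : S n) (gamma : seq (S n.+1)) (E : S n.+1),
      Gamma lambda B (rcons gamma E) ->
      m n B `^ p^-1 <= \sum_(C <- gamma) m n.+1 C `^ p^-1
  }.

(** * Weights on all levels *)

Section weight_construction.
Context {R : realType} {X : metricType R} {kappa a : R}.
Variable S : covering_system X kappa a.
Variable parent : forall n, S n.+1 -> S n.
Variables (p lambda KD KP s1 eps0 : R).
Hypothesis p0 : 0 < p.
Hypothesis lambda32 : 32 <= lambda.
Hypothesis kappa1 : 1 <= kappa.
Hypothesis KD1 : 1 <= KD.
Hypothesis dbl : doubling X KD.
Hypothesis KP1 : 1 < KP.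
Hypothesis perf : uniformly_perfect X KP.
Hypothesis X2 : exists x y : X, x != y.
Hypothesis a_ge : 6 * kappa ^+ 2 * Num.max lambda KP <= a.
Hypothesis par : is_parent parent.
Hypothesis s1_ge : 4 <= s1.
Hypothesis s1_KD : KD * expR (- (s1 / (4 * kappa))) <= 2^-1.

Let s := 16 * kappa ^+ 2 * s1.
Let A := 2 `^ p * expR (s * (2 * lambda * kappa)) * expR (s * (4 * kappa)).
Hypothesis eps0_le : A * expR (s * (4 * kappa)) * 4 * eps0 <= 4^-1.

Variable sigma : forall n, S n -> R.
Hypothesis sigma0 : forall n (B : S n), 0 <= sigma B.
Hypothesis sigma_path : forall k (B : S k) (gamma : seq (S k.+1)),
  Gamma lambda B gamma -> 1 <= \sum_(C <- gamma) sigma C.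
Hypothesis sigma_sum : forall k (B : S k),
  \sum_(B' : S k.+1 | parent B' == B) sigma B' `^ p <= eps0.

Let k0 : 0 < kappa. Proof. by move: kappa1; lra. Qed.
Let kk1 : 1 <= kappa ^+ 2. Proof. by rewrite exprn_ege1. Qed.
Let a_lambda : 6 * lambda <= a.
Proof.
apply: le_trans a_ge; apply: (@le_trans _ _ (6 * kappa ^+ 2 * lambda)).
  rewrite ler_wpM2r//; first by move: lambda32; lra.
  by move: kk1; lra.
by rewrite ler_wpM2l// ?le_max ?lexx//; move: kk1; lra.
Qed.
Let a192 : 192 * kappa ^+ 2 <= a.
Proof.
apply: le_trans a_ge; rewrite (_ : 192 * _ = 6 * kappa ^+ 2 * 32); last by ring.
by rewrite ler_wpM2l// ?le_max ?lambda32//; move: kk1; lra.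
Qed.
Let a_KP : 6 * kappa ^+ 2 * KP <= a.
Proof.
apply: le_trans a_ge.
by rewrite ler_wpM2l// ?le_max ?lexx ?orbT//; move: kk1; lra.
Qed.
Let a2 : 2 <= a. Proof. by move: a192 kk1; lra. Qed.
Let a0 : 0 < a. Proof. by move: a2; lra. Qed.
Let an0 n : 0 < a ^+ n. Proof. by rewrite exprn_gt0. Qed.
Let s0 : 0 < s.
Proof. by rewrite /s !mulr_gt0// ?exprn_gt0//; move: s1_ge; lra. Qed.

(** Each entry but the last pays for itself and its successor, so the last one is paid for although
    [g] is not summed over it. *)
Lemma sum_sorted_le (T : Type) (e : rel T) (f g : T -> R) (t : R) x (l : seq T) y :
  0 <= t -> (forall z, 0 <= f z) ->
  (forall z z', e z z' -> (f z + f z') * t <= g z) ->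
  path e x (rcons l y) ->
  (\sum_(z <- x :: rcons l y) f z) * t <= \sum_(z <- x :: l) g z.
Proof.
move=> t0 f0 efg; elim: l x => [|z l IH] x /=.
  by rewrite andbT !big_cons !big_nil !addr0; exact: efg.
case/andP => xz /IH; rewrite big_cons mulrDl => le.
rewrite [leRHS]big_cons lerD//; apply: le_trans (efg _ _ xz).
by rewrite ler_wpM2r// lerDl.
Qed.

Section path_property.
Variables (k : nat) (m : S k -> R) (m' : S k.+1 -> R).
Hypothesis m_ge0 : forall B, 0 <= m B.
Hypothesis mm' : forall (B' F' : S k.+1) (C : S k),
  mdist (center B') (center F') <= 2 * lambda * kappa * a ^- k.+1 ->
  mdist (center C) (center F') <= 3 * kappa * a ^- k ->
  (2 * sigma F') `^ p * m C <= m' B'.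

(** Averaging [mm'] at [F' = C] and at the successor [F' = D] of [C] turns the factor 2 into
    [sigma C + sigma D], which is what [sum_sorted_le] needs. *)
Lemma path_weight_le (B : S k) (gamma : seq (S k.+1)) (E : S k.+1) :
  Gamma lambda B (rcons gamma E) ->
  m B `^ p^-1 <= \sum_(C <- gamma) m' C `^ p^-1.
Proof.
move=> gG; have := sigma_path gG; move: gG.
have r0 : 0 < kappa * a ^- k by rewrite mulr_gt0// invr_gt0.
case: gamma => [|B1 gamma]; rewrite /Gamma/=.
  case=> _ [BE _ BE']; exfalso; apply: BE'; rewrite /dilate ballEmdist/=.
  by have := mdist_center_mem BE; rewrite -mulrA; lra.
case=> pth [BB1 int end_] sum1.
have nearE (C D : S k.+1) : neighbor lambda C D ->
    mdist (center C) (center D) <= 2 * lambda * kappa * a ^- k.+1.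
  case=> y []; rewrite /dilate !ballEmdist/= => h1 h2.
  have := metric_triangle (center C) y (center D).
  by rewrite (metric_sym y) -!mulrA; rewrite -!mulrA in h1 h2; lra.
have rr : 2 * lambda * kappa * a ^- k.+1 <= kappa * a ^- k.
  rewrite exprS invfM (_ : _ * _ = (2 * lambda / a) * (kappa * a ^- k)); last by ring.
  rewrite ler_piMl ?(ltW r0)// ler_pdivrMr//.
  by move: a_lambda lambda32; lra.
have close1 C : C \in B1 :: gamma -> mdist (center B) (center C) <= 2 * kappa * a ^- k.
  rewrite inE => /orP[/eqP ->|Cg].
    by have := mdist_center_mem BB1; rewrite -mulrA; lra.
  have := int C; rewrite belast_rcons/= => /(_ Cg).
  by rewrite /dilate ballEmdist/= => /ltW.
(* All cells but the last have their center in [2 . B]; the last is one step further, and by [rr] a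
   step is at most [kappa * r_k]. *)
have close C : C \in rcons (B1 :: gamma) E -> mdist (center B) (center C) <= 3 * kappa * a ^- k.
  rewrite mem_rcons inE => /orP[/eqP ->|Cg]; last first.
    by have := close1 _ Cg; rewrite -!mulrA; lra.
  have := close1 _ (mem_last B1 gamma).
  have : neighbor lambda (last B1 gamma) E.
    by move: pth; rewrite rcons_path => /andP[_ /andP[/asboolP]].
  move=> /nearE; have := metric_triangle (center B) (center (last B1 gamma)) (center E).
  rewrite -!mulrA; rewrite -!mulrA in rr; lra.
have := @sum_sorted_le _ (fun C D => [&& `[< neighbor lambda C D >],
    C \in rcons (B1 :: gamma) E & D \in rcons (B1 :: gamma) E]) (@sigma k.+1)
    (fun C => m' C `^ p^-1) (m B `^ p^-1) B1 gamma E.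
move=> /(_ (powR_ge0 _ _) (@sigma0 _)) le.
apply: le_trans (le _ _).
- by rewrite ler_peMl// powR_ge0.
- move=> C D /and3P[/asboolP CD Cg Dg].
  have key (F' : S k.+1) : mdist (center C) (center F') <= 2 * lambda * kappa * a ^- k.+1 ->
    mdist (center B) (center F') <= 3 * kappa * a ^- k ->
    2 * sigma F' * m B `^ p^-1 <= m' C `^ p^-1.
    move=> h1 h2; have := mm' h1 h2.
    have sF : 0 <= 2 * sigma F' by rewrite mulr_ge0.
    have pV : 0 <= p^-1 by rewrite invr_ge0 ltW.
    move=> h; have m'C : 0 <= m' C by apply: le_trans h; rewrite mulr_ge0 ?powR_ge0.
    have := @ge0_ler_powR _ p^-1 pV ((2 * sigma F') `^ p * m B) (m' C).
    rewrite !nnegrE mulr_ge0 ?powR_ge0// m'C => /(_ isT isT h).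
    by rewrite powRM ?powR_ge0// -powRrM mulfV ?gt_eqF// powRr1.
  have hC := key C; rewrite mdistxx in hC.
  have := hC _ (close _ Cg); have := key D (nearE _ _ CD) (close _ Dg).
  have -> : 0 <= 2 * lambda * kappa / a ^+ k.+1.
    by rewrite !mulr_ge0 ?invr_ge0 ?(ltW (an0 _)) ?(ltW k0)//; move: lambda32; lra.
  by move=> + /(_ isT); lra.
move: pth; have : {subset B1 :: rcons gamma E <= rcons (B1 :: gamma) E} by move=> z.
move: (rcons (B1 :: gamma) E) => G.
elim: (rcons gamma E) B1 {BB1 int end_ sum1 close1 close le} => //= D l IH C sub.
case/andP => /andP[CD _] pth; rewrite CD !sub ?inE ?eqxx ?orbT//=.
by apply: IH => // z zl; apply: sub; rewrite inE zl orbT.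
Qed.

End path_property.

(* The only place where uniform perfectness is used: two children in every cell
   make the weights decay. *)
Lemma sibling_exists k (D : S k) (B' : S k.+1) :
  ((a ^- k / (3 * kappa))%:E <= ediam [set: X])%E -> parent B' = D ->
  exists2 F' : S k.+1, F' != B' & parent F' = D.
Proof.
move=> rk B'D.
have r0 : 0 < a ^- k / (3 * kappa) by rewrite divr_gt0 ?invr_gt0 ?mulr_gt0.
(* The radius [r_k / (3 * kappa)] is small enough for the cells around [y] and around the center of
   [D] to be children of [D], and after division by [KP] still at least [2 * kappa * r_(k+1)], so
   that these two cells differ. *)
have [y []] := perf (center D) r0 rk.
rewrite !ballEmdist/= => h1 /negP; rewrite -leNgt => h2.
have [F Fy] := level_coverP S k.+1 y.
have [G GD] := level_coverP S k.+1 (center D).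
have nF := mdist_center_mem Fy; have nG := mdist_center_mem GD.
have rk1 : 0 < a ^- k by rewrite invr_gt0.
have e1 : 2 * (kappa * a ^- k.+1) <= KP^-1 * (a ^- k / (3 * kappa)).
  rewrite exprS invfM [leLHS](_ : _ = (2 * kappa / a) * a ^- k); last by field; rewrite !gt_eqF.
  rewrite [leRHS](_ : _ = ((3 * kappa * KP)^-1) * a ^- k); last first.
    by field; rewrite !gt_eqF//; move: KP1; lra.
  rewrite ler_wpM2r ?(ltW rk1)// ler_pdivrMr//.
  rewrite [leRHS]mulrC ler_pdivlMr ?mulr_gt0//; last by move: KP1; lra.
  by rewrite [leLHS](_ : _ = 6 * kappa ^+ 2 * KP)//; ring.
have e2 : a ^- k / (3 * kappa) + kappa * a ^- k.+1 < kappa^-1 * a ^- k / 2.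
  rewrite exprS invfM [ltRHS](_ : _ = (3 / 6 / kappa) * a ^- k); last by field; rewrite !gt_eqF.
  rewrite [ltLHS](_ : _ = (2 / 6 / kappa + kappa / a) * a ^- k); last first.
    by field; rewrite !gt_eqF.
  rewrite ltr_pM2r// -ltrBrDl [ltRHS](_ : _ = 6^-1 / kappa); last by ring.
  rewrite ltr_pdivrMr// -mulrA ltr_pdivlMl// mulrC ltr_pdivlMl//.
  by move: a192 kk1; rewrite expr2; lra.
have dG : mdist (center G) (center D) < kappa^-1 * a ^- k / 2.
  by apply: lt_trans nG _; apply: le_lt_trans e2; rewrite lerDr ltW.
have dF : mdist (center F) (center D) < kappa^-1 * a ^- k / 2.
  apply: (le_lt_trans (metric_triangle _ y _)); apply: le_lt_trans e2.
  by rewrite (metric_sym y) addrC ltW// ltrD.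
have pF := parent_of_close kappa1 a192 par dF.
have pG := parent_of_close kappa1 a192 par dG.
have FG : F != G.
  apply/eqP => FG; rewrite -FG in nG.
  have := metric_triangle (center D) (center F) y.
  by rewrite (metric_sym (center D) (center F)); lra.
have [FB|FB] := eqVneq F B'; last by exists F.
by exists G => //; rewrite -FB eq_sym.
Qed.

Lemma conformal_weight_exists : exists (rho : R) (k1 : nat) (m : forall n, S n -> R),
  0 < rho < 1 /\ conformal_weight parent p lambda s rho k1 m.
Proof.
pose eta := expR (- (s * a / (4 * kappa))).
pose rho := eta * expR (- (2 * s * kappa)).
have rho0 : 0 < rho by rewrite mulr_gt0// expR_gt0.
have rho1 : rho < 1.
  rewrite /rho /eta -expRD -[ltRHS]expR0 ltr_expR.
  have : 0 < s * a / (4 * kappa) by apply: divr_gt0 (mulr_gt0 s0 a0) _; rewrite mulr_gt0.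
  have : 0 < 2 * s * kappa by exact: mulr_gt0 (mulr_gt0 (ltr0Sn _ 1) s0) k0.
  lra.
have aux (r x u v w : R) : 0 <= x -> r * w <= u -> v + (u + x) = w -> v <= (1 - r) * w.
  lra.
(* Positivity and the Lipschitz bound travel with the weight, since the next step needs them; the
   relations between two levels are read off afterwards. *)
pose T k := {m : S k -> R | (forall B, 0 < m B) /\ (forall B B' : S k,
  @expker R X a s k (center B) (center B') * m B <= m B')}.
have step k (m : T k) : exists m' : T k.+1,
  [/\ forall B', rho * sval m (parent B') <= sval m' B',
      forall (B' F' : S k.+1) C, mdist (center B') (center F') <= 2 * lambda * kappa * a ^- k.+1 ->
        mdist (center C) (center F') <= 3 * kappa * a ^- k ->
        (2 * sigma F') `^ p * sval m C <= sval m' B'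
    & forall B, \sum_(B' : S k.+1 | parent B' == B) sval m' B' = sval m B].
  case: m => m [m0 mlip] /=.
  have [m' [h1 h2 h3 h4]] := weight_step lambda32 kappa1 KD1 dbl a192 par s1_ge s1_KD
    m0 mlip (@sigma0 _) (sigma_sum (k := k)) eps0_le.
  have m'0 B : 0 < m' B by apply: lt_le_trans (h2 B); rewrite mulr_gt0.
  by exists (exist _ m' (conj m'0 h1)).
have initP : (forall B : S 0%N, 0 < (1 : R)) /\ (forall B B' : S 0%N,
    @expker R X a s 0 (center B) (center B') * 1 <= 1).
  split=> // B B'; rewrite mulr1 /expker -[leRHS]expR0 ler_expR oppr_le0.
  by rewrite mulr_ge0 ?(ltW s0)// mulr_ge0 ?mdist_ge0// ltW.
pose init : T 0%N := exist _ (fun=> 1) initP.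
pose f := fix f k : T k := if k is k'.+1 then sval (cid (step _ (f k'))) else init.
have [k1 k1P] : exists k1, forall k, (k1 <= k)%N ->
    ((a ^- k / (3 * kappa))%:E <= ediam [set: X])%E.
  have [x [y xy]] := X2.
  have [|n0 n0P] := @expVn_le_eps _ a (mdist x y * (3 * kappa)) a2.
    by rewrite !mulr_gt0// mdist_gt0.
  exists n0 => k n0k; apply: (@le_trans _ _ (mdist x y)%:E).
    by rewrite lee_fin ler_pdivrMr ?mulr_gt0// n0P.
  exact: mdist_le_ediam.
have fP k := svalP (cid (step _ (f k))).
have m0 n B : 0 < sval (f n) B by case: (f n) => m [].
exists rho, k1, (fun n => sval (f n)); split; first by rewrite rho0.
split => //.
- by move=> n; case: (f n) => m [].
- by move=> n; case: (fP n).
- move=> n B n0; have [h1 h2 h3] := fP n.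
  (* The sibling [F] keeps at least the fraction [rho] of the parent's weight, which leaves at most
     [1 - rho] for [B]. *)
  have [F FB FD] := sibling_exists (k1P _ n0) (erefl (parent B)).
  have := h3 (parent B); rewrite (bigD1 B)//= (bigD1 F)/=; last by rewrite FD eqxx.
  have := h1 F; rewrite FD.
  set x := \sum_(i | _) _; have : 0 <= x.
    by rewrite sumr_ge0// => C _; exact: ltW (m0 n.+1 C).
  change (sval (sval (cid (step n (f n))))) with (sval (f n.+1)).
  by move=> x0 le eq; exact: aux x0 le eq.
- by move=> n; case: (fP n).
- move=> n B gamma E; apply: path_weight_le => [C|]; first exact: ltW.
  by case: (fP n).
Qed.

End weight_construction.

(** * Chains of cells and their reduction to coarser levels *)

Section chain_definitions.
Context {R : realType} {X : metricType R} {kappa a : R}.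
Variable S : covering_system X kappa a.
Variables (p : R) (m : forall n, S n -> R).

Definition node := {n : nat & S n}.

Definition node_disk (e : node) : X * R := (center (tagged e), a ^- tag e).

Definition node_weight (e : node) : R := m (tagged e) `^ p^-1.

Definition chain_cost (l : seq node) : R := \sum_(e <- l) node_weight e.

(* Cells are seen as disks (center, r_n) and points as disks of radius 0. *)
Definition linked (g : R) (P Q : X * R) :=
  mdist P.1 Q.1 <= 2 * kappa * (P.2 + Q.2) + g.

Definition chain (g : R) (P : X * R) (l : seq node) (Q : X * R) :=
  path (linked g) P (rcons (map node_disk l) Q).

(* The slack allowed in chains of levels at most [n]: dropping a run of cells of
   level [n.+1] costs 3 kappa r_n + 2 (4 kappa r_(n+1) + gap (n+1)) <= gap n. *)
Definition gap n : R := 5 * kappa * a ^- n.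

End chain_definitions.

Arguments gap {R} kappa a n.
Arguments linked {R X} kappa g P Q.

Section chain_reduction.
Context {R : realType} {X : metricType R} {kappa a : R}.
Variable S : covering_system X kappa a.
Variables (p lambda : R) (m : forall n, S n -> R).
Hypothesis lambda32 : 32 <= lambda.
Hypothesis kappa1 : 1 <= kappa.
Hypothesis a_ge : 192 * kappa ^+ 2 <= a.
Hypothesis weight_path : forall n (B : S n) (gamma : seq (S n.+1)) (E : S n.+1),
  Gamma lambda B (rcons gamma E) ->
  m B `^ p^-1 <= \sum_(C <- gamma) m C `^ p^-1.

Local Notation cost := (chain_cost p m).
Local Notation gap := (@gap R kappa a).
Local Notation linked := (@linked R X kappa).
Local Notation disk := (@node_disk R X kappa a S).

Let k0 : 0 < kappa. Proof. by move: kappa1; lra. Qed.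
Let kk1 : 1 <= kappa ^+ 2. Proof. by rewrite exprn_ege1. Qed.
Let a192 : 192 <= a. Proof. by move: a_ge kk1; lra. Qed.
Let a0 : 0 < a. Proof. by move: a192; lra. Qed.
Let r0 n : 0 < kappa * a ^- n. Proof. by rewrite mulr_gt0// invr_gt0 exprn_gt0. Qed.

Let rS n : 192 * (kappa * a ^- n.+1) <= kappa * a ^- n.
Proof.
rewrite exprS invfM [leLHS](_ : _ = (192 / a) * (kappa * a ^- n)); last by ring.
by rewrite ler_piMl ?(ltW (r0 n))// ler_pdivrMr// mul1r.
Qed.

Lemma cost_ge0 l : 0 <= cost l.
Proof. by rewrite sumr_ge0// => e _; exact: powR_ge0. Qed.

Lemma cost_cons e l : cost (e :: l) = m (tagged e) `^ p^-1 + cost l.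
Proof. by rewrite /chain_cost big_cons. Qed.

(* In the second part a run [B1 :: gamma] of cells of level [n.+1] has started in
   [B] and not left [2 B] yet.  When it leaves, [B] replaces it, at no larger
   cost by [weight_path]; when a coarser cell or [Q] comes first, it is dropped. *)
Lemma reduce_level n l : all (fun e : node S => tag e <= n.+1)%N l ->
  (forall P Q, chain (gap n.+1) P l Q ->
    exists l', [/\ all (fun e : node S => tag e <= n)%N l', chain (gap n) P l' Q &
      cost l' <= cost l]) /\
  (forall P Q (B : S n) (B1 : S n.+1) (gamma : seq (S n.+1)),
    val B (center B1) -> horizontal_path lambda (B1 :: gamma) ->
    (forall C, C \in gamma -> dilate 2 B (center C)) ->
    mdist P.1 (center B1) <= 2 * kappa * P.2 + 9 * kappa * a ^- n.+1 ->
    chain (gap n.+1) (disk (existT _ n.+1 (last B1 gamma))) l Q ->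
    exists l', [/\ all (fun e : node S => tag e <= n)%N l', chain (gap n) P l' Q &
      cost l' <= \sum_(C <- B1 :: gamma) m C `^ p^-1 + cost l]).
Proof.
have rn := r0 n; have rn1 := r0 n.+1; have rSn := rS n.
have near_last (B : S n) (B1 : S n.+1) gamma :
    val B (center B1) -> (forall C, C \in gamma -> dilate 2 B (center C)) ->
    mdist (center B) (center (last B1 gamma)) <= 2 * kappa * a ^- n.
  move=> BB1 Bg; have d1 := mdist_center_mem BB1.
  have := mem_last B1 gamma; rewrite inE => /orP[/eqP ->|/Bg].
    by rewrite -mulrA; lra.
  by rewrite /dilate ballEmdist/= => /ltW.
have drop P (B : S n) (B1 : S n.+1) gamma (Q : X * R) :
    val B (center B1) -> (forall C, C \in gamma -> dilate 2 B (center C)) ->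
    mdist P.1 (center B1) <= 2 * kappa * P.2 + 9 * kappa * a ^- n.+1 ->
    linked (gap n.+1) (disk (existT _ n.+1 (last B1 gamma))) Q ->
    linked (gap n) P Q.
  move=> BB1 Bg PB1; rewrite /linked /gap /=.
  have d1 := mdist_center_mem BB1.
  have d2 := near_last _ _ _ BB1 Bg.
  have t1 := metric_triangle P.1 (center B1) Q.1.
  have t2 := metric_triangle (center B1) (center (last B1 gamma)) Q.1.
  have t3 := metric_triangle (center B1) (center B) (center (last B1 gamma)).
  rewrite (metric_sym (center B1) (center B)) in t3.
  move=> LQ; lra.
elim: l => [|[k E] l IH] /= lvl.
  split=> [P Q|P Q B B1 gamma BB1 _ Bg PB1].
    rewrite /chain/= andbT => PQ; exists [::]; split=> //.
    rewrite /chain/= andbT /linked; apply: (le_trans PQ); rewrite lerD2l /gap; lra.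
  rewrite /chain/= andbT => lQ; exists [::]; split=> //.
    by rewrite /chain/= andbT; exact: (drop _ B B1 gamma).
  by rewrite lerDr sumr_ge0// => C _; exact: powR_ge0.
have {lvl} [kn lvl] := andP lvl.
have [IHA IHB] := IH lvl.
have [kn'|kn'] := leqP k n.
  have low P Q : linked (gap n) P (disk (existT _ k E)) ->
      chain (gap n.+1) (disk (existT _ k E)) l Q ->
      exists l', [/\ all (fun e : node S => tag e <= n)%N l', chain (gap n) P l' Q &
      cost l' <= cost (existT _ k E :: l)].
    move=> PE /IHA[l' [h1 h2 h3]]; exists (existT _ k E :: l'); split => /=.
    - by rewrite kn'.
    - by rewrite /chain/= PE.
    - by rewrite !cost_cons lerD2l.
  split=> [P Q|P Q B B1 gamma BB1 _ Bg PB1]; rewrite /chain/= => /andP[PE El].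
    apply: low => //; apply: (le_trans PE); rewrite lerD2l /gap; lra.
  have [l' [h1 h2 h3]] := low P Q (drop _ _ _ _ _ BB1 Bg PB1 PE) El.
  exists l'; split=> //; apply: (le_trans h3).
  by rewrite lerDr sumr_ge0// => C _; exact: powR_ge0.
have kE : k = n.+1 by apply/eqP; rewrite eqn_leq kn.
subst k => {kn kn'}.
have start P Q : mdist P.1 (center E) <= 2 * kappa * P.2 + 9 * kappa * a ^- n.+1 ->
    chain (gap n.+1) (disk (existT _ n.+1 E)) l Q ->
    exists l', [/\ all (fun e : node S => tag e <= n)%N l', chain (gap n) P l' Q &
      cost l' <= cost (existT _ n.+1 E :: l)].
  move=> PE El; have [B BE] := level_coverP S n (center E).
  have [//|//|l' [h1 h2 h3]] := IHB P Q B E [::] BE _ _ PE El.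
  by exists l'; split=> //; rewrite cost_cons; move: h3; rewrite big_seq1.
split=> [P Q|P Q B B1 gamma BB1 hg Bg PB1].
  rewrite /chain/= => /andP[PE El]; apply: start => //.
  by move: PE; rewrite /linked /gap/=; lra.
rewrite /chain/= => /andP[LE El].
have costE : cost l <= cost (existT _ n.+1 E :: l) by rewrite cost_cons lerDr powR_ge0.
(* A repeated cell is dropped, because consecutive cells of a horizontal path must differ. *)
have [EL|EL] := eqVneq E (last B1 gamma).
  rewrite EL in El; have [l' [h1 h2 h3]] := IHB P Q B B1 gamma BB1 hg Bg PB1 El.
  by exists l'; split=> //; apply: (le_trans h3); rewrite lerD2l.
have nb : neighbor lambda (last B1 gamma) E.
  exists (center E); split; rewrite /dilate ballEmdist/=.
    apply: (le_lt_trans LE); rewrite /gap/=.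
    have : 32 * (kappa / a ^+ n.+1) <= lambda * (kappa / a ^+ n.+1) by rewrite ler_wpM2r// ltW.
    lra.
  by rewrite mdistxx -mulrA mulr_gt0//; move: lambda32; lra.
have hg' : horizontal_path lambda (rcons (B1 :: gamma) E).
  rewrite /horizontal_path/= rcons_path; apply/andP; split=> //.
  by rewrite eq_sym EL andbT; apply/asboolP.
have [BE|BE] := pselect (dilate 2 B (center E)).
  have [|||l' [h1 h2 h3]] := IHB P Q B B1 (rcons gamma E) BB1 _ _ PB1 _.
  - exact: hg'.
  - by move=> C; rewrite mem_rcons inE => /orP[/eqP ->|/Bg].
  - by rewrite last_rcons; exact: El.
  exists l'; split=> //; apply: (le_trans h3).
  by rewrite -rcons_cons -cats1 big_cat big_seq1 cost_cons addrA.
have G : Gamma lambda B (rcons (B1 :: gamma) E).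
  split=> //=; split=> //; last by rewrite last_rcons.
  by move=> C; rewrite belast_rcons/=; exact: Bg.
have le1 := weight_path G.
(* [E] opens a new run after [B]. The bound [9 * kappa * r_(n+1)] is [4 + 5]: a link between two
   cells of level [n.+1], plus the slack [gap n.+1]. *)
have [|l' [h1 h2 h3]] := start (center B, a ^- n) Q _ El.
  have := near_last _ _ _ BB1 Bg; move: LE; rewrite /linked /gap/=.
  have := metric_triangle (center B) (center (last B1 gamma)) (center E); lra.
exists (existT _ n B :: l'); split=> /=.
- by rewrite leqnn.
- rewrite /chain/=; apply/andP; split=> //.
  have := mdist_center_mem BB1; rewrite metric_sym /linked /gap/=.
  by have := metric_triangle P.1 (center B1) (center B); lra.
- by rewrite [leLHS]cost_cons; apply: lerD.
Qed.

End chain_reduction.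

Section reduction_iterated.
Context {R : realType} {X : metricType R} {kappa a : R}.
Variable S : covering_system X kappa a.
Variables (p lambda : R) (m : forall n, S n -> R).
Hypothesis lambda32 : 32 <= lambda.
Hypothesis kappa1 : 1 <= kappa.
Hypothesis a_ge : 192 * kappa ^+ 2 <= a.
Hypothesis weight_path : forall n (B : S n) (gamma : seq (S n.+1)) (E : S n.+1),
  Gamma lambda B (rcons gamma E) ->
  m B `^ p^-1 <= \sum_(C <- gamma) m C `^ p^-1.

Lemma reduce_levels j n l P Q : all (fun e : node S => tag e <= j + n)%N l ->
  chain (gap kappa a (j + n)) P l Q ->
  exists l', [/\ all (fun e : node S => tag e <= n)%N l', chain (gap kappa a n) P l' Q &
    chain_cost p m l' <= chain_cost p m l].
Proof.
elim: j l => [|j IH] l lvl Pl; first by exists l.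
have [+ _] := reduce_level lambda32 kappa1 a_ge weight_path (n := j + n) lvl.
move=> /(_ P Q Pl)[l1 [h1 h2 h3]].
have [l2 [h4 h5 h6]] := IH l1 h1 h2.
by exists l2; split=> //; exact: le_trans h3.
Qed.

End reduction_iterated.

(** * The chain metric *)

Section chain_metric.
Context {R : realType} {X : metricType R} {kappa a : R}.
Variable S : covering_system X kappa a.
Variable parent : forall n, S n.+1 -> S n.
Variables (p lambda s rho : R) (k1 : nat) (m : forall n, S n -> R).
Hypothesis p0 : 0 < p.
Hypothesis lambda32 : 32 <= lambda.
Hypothesis kappa1 : 1 <= kappa.
Hypothesis a_ge : 192 * kappa ^+ 2 <= a.
Hypothesis par : is_parent parent.
Hypothesis s0 : 0 < s.
Hypothesis rho01 : 0 < rho < 1.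
Hypothesis cw : conformal_weight parent p lambda s rho k1 m.

Let k0 : 0 < kappa. Proof. by move: kappa1; lra. Qed.
Let kk1 : 1 <= kappa ^+ 2. Proof. by rewrite exprn_ege1. Qed.
Let a192 : 192 <= a. Proof. by move: a_ge kk1; lra. Qed.
Let a2 : 2 <= a. Proof. by move: a192; lra. Qed.
Let a1 : 1 <= a. Proof. by move: a192; lra. Qed.
Let a0 : 0 < a. Proof. by move: a192; lra. Qed.
Let r0 n : 0 < a ^- n. Proof. by rewrite invr_gt0 exprn_gt0. Qed.
Let rho0 : 0 < rho. Proof. by move: rho01; lra. Qed.
Let rho1 : rho < 1. Proof. by move: rho01; lra. Qed.
Let pV0 : 0 < p^-1. Proof. by rewrite invr_gt0. Qed.

Lemma expVn_le (n j : nat) : a ^- (j + n) <= a ^- n.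
Proof.
by rewrite lef_pV2 ?posrE ?exprn_gt0// ler_weXn2l ?leq_addl.
Qed.

(** The level is written [j + n] so that [j.+1 + n] reduces to a successor and [parent] applies
    without a cast. *)
Fixpoint ancestor (n j : nat) : S (j + n) -> S n :=
  if j is j'.+1 then fun B => ancestor (parent B) else id.

(** The subtracted term makes the geometric sum telescope: a step to the parent costs [kappa * r],
    at most [2 * kappa] times the drop from [r] to [r / a]. *)
Lemma ancestor_near (n j : nat) (B : S (j + n)) :
  mdist (center (ancestor B)) (center B) <= 2 * kappa * (a ^- n - a ^- (j + n)).
Proof.
elim: j B => [|j IH] B /=; first by rewrite mdistxx subrr mulr0.
have h1 := IH (parent B).
have h2 := voronoi_near (par B).
rewrite metric_sym in h2.
apply: (le_trans (metric_triangle _ (center (parent B)) _)).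
apply: (@le_trans _ _ (2 * kappa * (a ^- n - a ^- (j + n)) + kappa * a ^- (j + n))).
  by rewrite lerD// ltW.
have : 2 * a ^- (j + n).+1 <= a ^- (j + n).
  rewrite exprS invfM mulrA ler_piMl ?(ltW (r0 _))//.
  by rewrite ler_pdivrMr// mul1r.
move=> /(ler_wpM2l (ltW k0)).
rewrite !mulrA addSn; lra.
Qed.

Lemma ancestor_near2 (n j : nat) (B : S (j + n)) :
  mdist (center (ancestor B)) (center B) <= 2 * kappa * a ^- n.
Proof.
apply: (le_trans (ancestor_near B)).
by rewrite ler_pM2l ?mulr_gt0// gerBl ltW.
Qed.

Lemma weight_gt0 n (B : S n) : 0 < m B.
Proof.
elim: n B => [|n IH] B; first by rewrite (weight_root cw).
by apply: lt_le_trans (weight_ge cw B); rewrite mulr_gt0.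
Qed.

Lemma weight_le_parent n (B : S n.+1) : m B <= m (parent B).
Proof.
rewrite -(weight_sum cw (parent B)) (bigD1 B)//= lerDl sumr_ge0// => C _.
exact/ltW/weight_gt0.
Qed.

Lemma weight_le_ancestor (n j : nat) (B : S (j + n)) : m B <= m (ancestor B).
Proof.
elim: j B => [|j IH] B //=; exact: le_trans (weight_le_parent B) (IH _).
Qed.

Lemma weight_ge_ancestor (n j : nat) (B : S (j + n)) : rho ^+ j * m (ancestor B) <= m B.
Proof.
elim: j B => [|j IH] B /=; first by rewrite mul1r.
apply: le_trans (weight_ge cw B); rewrite exprS -mulrA ler_wpM2l ?(ltW rho0)//.
Qed.

(* The factor compensates for the levels below [k1], where the weight need
   not decrease. *)
Lemma weight_decay_ancestor (n j : nat) (B : S (j + n)) :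
  m B <= (1 - rho) ^- k1 * (1 - rho) ^+ j * m (ancestor B).
Proof.
have d0 : 0 < 1 - rho by move: rho1; lra.
have d1 : 1 - rho <= 1 by move: rho0; lra.
suff main : m B <= (1 - rho) ^- (k1 - n) * (1 - rho) ^+ j * m (ancestor B).
  apply: (le_trans main); rewrite ler_wpM2r ?(ltW (weight_gt0 _))//.
  rewrite ler_wpM2r ?exprn_ge0 ?(ltW d0)// lef_pV2 ?posrE ?exprn_gt0//.
  by rewrite ler_wiXn2l ?(ltW d0)// leq_subr.
have [kn|kn] := leqP k1 n.
  rewrite (eqP kn) expr0 invr1 mul1r.
  elim: j B => [|j IH] B /=; first by rewrite mul1r.
  apply: (le_trans (weight_decay cw B _)); first by rewrite (leq_trans kn)// leq_addl.
  by rewrite exprS -mulrA ler_wpM2l ?(ltW d0)//; exact: IH.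
(* While [j <= k1 - n] the factor is at least 1 and monotonicity is enough; from there on every
   level brings a factor [1 - rho]. *)
have [j0|//] : (j <= k1 - n)%N \/ m B <= (1 - rho) ^- (k1 - n) * (1 - rho) ^+ j * m (ancestor B);
  last first.
  apply: (le_trans (weight_le_ancestor B)).
  rewrite ler_peMl ?(ltW (weight_gt0 _))// ler_pdivlMl ?exprn_gt0// mulr1.
  by rewrite ler_wiXn2l ?(ltW d0).
elim: j B => [|j IH] B /=; first by left.
have [jk|jk] := ltnP j (k1 - n); first by left.
right; apply: (le_trans (weight_decay cw B _)).
  by move: jk; rewrite leq_subLR addnC.
rewrite exprS mulrCA -mulrA ler_wpM2l ?(ltW d0)//.
have [j0|//] := IH (parent B).
have je : j = (k1 - n)%N by apply/eqP; rewrite eqn_leq j0.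
rewrite [X in X * m _](_ : _ = 1); last by rewrite -je mulVf ?gt_eqF ?exprn_gt0.
by rewrite mul1r; exact: weight_le_ancestor.
Qed.

Definition diam_weight n (B : S n) := m B `^ p^-1.

Lemma wt_gt0 n (B : S n) : 0 < diam_weight B.
Proof. by rewrite powR_gt0 ?weight_gt0. Qed.

Lemma wt_le n n' (B : S n) (B' : S n') (c : R) : 0 <= c -> m B <= c * m B' ->
  diam_weight B <= c `^ p^-1 * diam_weight B'.
Proof.
move=> c0 le; rewrite -powRM ?(ltW (weight_gt0 _))//.
apply: ge0_ler_powR => //; rewrite ?nnegrE ?(ltW pV0) ?(ltW (weight_gt0 _))//.
by rewrite mulr_ge0 ?(ltW (weight_gt0 _)).
Qed.

Lemma wt_lip n (B B' : S n) t : mdist (center B) (center B') <= t * a ^- n ->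
  diam_weight B <= expR (s * t / p) * diam_weight B'.
Proof.
move=> BB'; rewrite expRM; apply: wt_le; first exact: expR_ge0.
rewrite -ler_pdivrMl ?expR_gt0// -expRN.
apply: le_trans (weight_lip cw B B'); rewrite ler_wpM2r ?(ltW (weight_gt0 _))//.
by apply: (expker_ge a1 (ltW s0)).
Qed.

Definition theta (x y : X) : R :=
  inf [set chain_cost p m l | l in [set l | chain 0 (x, 0) l (y, 0)]].

Let costs_lb x y : has_lbound [set chain_cost p m l | l in
  [set l | chain (S := S) 0 (x, 0) l (y, 0)]].
Proof. by exists 0 => _ [l _ <-]; exact: cost_ge0. Qed.

Lemma theta_le_cost x y l : chain (S := S) 0 (x, 0) l (y, 0) -> theta x y <= chain_cost p m l.
Proof. by move=> xly; apply: ge_inf => //; exists l. Qed.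

Lemma chain1 n (B : S n) x y : val B x -> val B y ->
  chain 0 (x, 0) [:: existT _ n B] (y, 0).
Proof.
move=> /(mdist_center_mem) Bx /mdist_center_mem By; rewrite /chain/= andbT /linked/=.
rewrite (metric_sym x) add0r !addr0; have := mulr_gt0 k0 (r0 n).
by move=> h; apply/andP; split; lra.
Qed.

(** The infimum runs over a nonempty set, since the root cell alone links any two points. *)
Lemma theta_ge x y c :
  (forall l, chain (S := S) 0 (x, 0) l (y, 0) -> c <= chain_cost p m l) ->
  c <= theta x y.
Proof.
move=> h; apply: lb_le_inf; last by move=> _ [l /h le <-].
have [B Bx] := level_coverP S 0 x.
exists (chain_cost p m [:: existT _ 0%N B]), [:: existT _ 0%N B] => //=.
apply: chain1 => //.
have -> : val B = [set: X]; last by [].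
have : val B \in level S 0 by exact: fsvalP.
by move: (val B) => C; rewrite (level0 S) inE => /eqP.
Qed.

Lemma theta_ge0 x y : 0 <= theta x y.
Proof. by apply: theta_ge => l _; exact: cost_ge0. Qed.

Lemma theta_le_wt n (B : S n) x y : val B x -> val B y -> theta x y <= diam_weight B.
Proof.
move=> Bx By; apply: le_trans (theta_le_cost (chain1 Bx By)) _.
by rewrite /chain_cost big_seq1.
Qed.

Lemma theta_upper n (B : S n) x y : val B x -> mdist x y <= 2 * kappa * a ^- n ->
  theta x y <= (1 + expR (s * (4 * kappa) / p)) * diam_weight B.
Proof.
move=> Bx xy; have [B' By] := level_coverP S n y.
have dx := mdist_center_mem Bx; have dy := mdist_center_mem By.
have BB' : mdist (center B) (center B') <= 4 * kappa * a ^- n.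
  have := metric_triangle (center B) x (center B').
  have := metric_triangle x y (center B').
  rewrite (metric_sym y); lra.
have : chain 0 (x, 0) [:: existT _ n B; existT _ n B'] (y, 0).
  rewrite /chain/= andbT /linked/=; rewrite (metric_sym x (center B)).
  have := mulr_gt0 k0 (r0 n) => h.
  by apply/andP; split; [lra|apply/andP; split; lra].
move=> /theta_le_cost /le_trans; apply.
rewrite /chain_cost big_cons big_seq1 mulrDl mul1r lerD2l.
by apply: wt_lip; rewrite metric_sym.
Qed.

(** Any chain reduces, at no larger cost, to a chain of levels at most [n] with slack [gap n]. As
    [x] and [y] are further apart than this slack, a cell remains; the first one, [E] of level
    [k <= n], is near [x], hence near the ancestor of [B] at level [k], which weighs at least as
    much as [B]. The distance bound is [10 = 2 + 1 + 2 + 5]: ancestor, cell, link and gap. *)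
Lemma theta_lower n (B : S n) x y : val B x -> gap kappa a n < mdist x y ->
  expR (- (s * (10 * kappa) / p)) * diam_weight B <= theta x y.
Proof.
move=> Bx xy; apply: theta_ge => l xly.
pose N := \max_(e <- l) tag e.
have lN : all (fun e : node S => tag e <= N + n)%N l.
  apply/allP => e el; rewrite (leq_trans _ (leq_addr _ _))//.
  by rewrite /N (big_rem e)//= leq_maxl.
have {}xly : chain (gap kappa a (N + n)) (x, 0) l (y, 0).
  apply: sub_path xly => P Q; rewrite /linked addr0 => /le_trans; apply.
  by rewrite lerDl /gap mulr_ge0 ?mulr_ge0 ?(ltW (r0 _)) ?(ltW k0).
have [l' [h1 h2 h3]] := reduce_levels lambda32 kappa1 a_ge (weight_path cw) lN xly.
apply: le_trans h3; case: l' h1 h2 => [_|[k E] l' /= /andP[kn _]].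
  by rewrite /chain/= andbT /linked/= addr0 mulr0 add0r leNgt xy.
rewrite /chain/= => /andP[+ _]; rewrite /linked/= add0r => xE.
rewrite cost_cons; apply: (@le_trans _ _ (diam_weight E)); last by rewrite lerDl cost_ge0.
rewrite expRN ler_pdivrMl ?expR_gt0//.
move: B Bx xE; rewrite -(subnK kn) => B Bx xE.
apply: (@le_trans _ _ (diam_weight (ancestor B))).
  have := @wt_le _ _ B (ancestor B) 1 ler01; rewrite powR1 !mul1r; apply.
  exact: weight_le_ancestor.
apply: wt_lip.
have d1 := ancestor_near2 B; have d2 := mdist_center_mem Bx.
have le := expVn_le k (n - k); set j := (n - k + k)%N in le d2 xE *.
have le' := ler_wpM2l (ltW k0) le.
have := metric_triangle (center (ancestor B)) (center B) (center E).
have := metric_triangle (center B) x (center E).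
by move: xE; rewrite /gap; lra.
Qed.

Lemma thetaxx x : theta x x = 0.
Proof.
apply/eqP; rewrite eq_le theta_ge0 andbT.
apply: (le_trans (theta_le_cost (l := [::]) _)); last by rewrite /chain_cost big_nil.
by rewrite /chain/= andbT /linked/= mdistxx !addr0 mulr0.
Qed.

Lemma theta_gt0 x y : x != y -> 0 < theta x y.
Proof.
rewrite -mdist_gt0 => xy.
have [|n0 n0P] := @expVn_le_eps _ a (mdist x y / (6 * kappa)) a2.
  by rewrite divr_gt0// mulr_gt0.
have [B Bx] := level_coverP S n0 x.
apply: lt_le_trans (theta_lower Bx _); first by rewrite mulr_gt0 ?expR_gt0 ?wt_gt0.
have := n0P _ (leqnn _); rewrite ler_pdivlMr ?mulr_gt0// /gap.
by have := mulr_gt0 k0 (r0 n0); lra.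
Qed.

Lemma theta_eq0 x y : theta x y = 0 -> x = y.
Proof. by move=> xy0; apply/eqP/negPn/negP => /theta_gt0; rewrite xy0 ltxx. Qed.

Lemma theta_sym x y : theta x y = theta y x.
Proof.
suff le u v : theta u v <= theta v u by apply/eqP; rewrite eq_le !le.
apply: theta_ge => l vlu; have -> : chain_cost p m l = chain_cost p m (rev l).
  by rewrite /chain_cost big_rev.
apply: theta_le_cost; move: vlu; rewrite /chain map_rev => vlu.
have := rev_path (linked kappa 0) (v, 0) (rcons (map (@node_disk _ _ _ _ S) l) (u, 0)).
rewrite last_rcons belast_rcons rev_cons => ->.
by apply: sub_path vlu => P Q; rewrite /linked metric_sym [Q.2 + _]addrC.
Qed.

Lemma theta_triangle y x z : theta x z <= theta x y + theta y z.
Proof.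
rewrite -lerBlDr; apply: theta_ge => l1 xly.
rewrite lerBlDr -lerBlDl; apply: theta_ge => l2 ylz.
rewrite lerBlDl; have -> : chain_cost p m l1 + chain_cost p m l2 = chain_cost p m (l1 ++ l2).
  by rewrite /chain_cost big_cat.
apply: theta_le_cost; move: xly ylz; rewrite /chain map_cat rcons_cat cat_path rcons_path.
move=> /andP[-> lst] /=.
case: (rcons (map _ l2) _) => //= P l /andP[yP ->]; rewrite andbT.
move: lst yP; rewrite /linked/=; set Q := last _ _.
rewrite !addr0 add0r => h1 h2.
by apply: (le_trans (metric_triangle _ y _)); rewrite mulrDr lerD.
Qed.

Definition chain_distance : distance R X :=
  Distance thetaxx theta_eq0 theta_sym theta_triangle.

End chain_metric.

(** * Quasisymmetry *)

Section power_distortion.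
Context {R : realType}.
Implicit Types (f g : R -> R) (s t u K al : R).

(** An increasing map onto the half-line cannot jump: [g (f t - e)] and [g (f t + e)] bracket a
    neighborhood of [t]. No lower bracket exists, or is required, when [f t < e]. *)
Lemma increasing_can_continuous f g :
  (forall t, 0 <= t -> 0 <= f t) -> (forall t, 0 <= t -> 0 <= g t) ->
  (forall s t, 0 <= s -> 0 <= t -> s < t -> f s < f t) ->
  (forall t, 0 <= t -> f (g t) = t) ->
  {within `[0, +oo[, continuous f}.
Proof.
move=> f0 g0 finc fg; apply/subspace_continuousP => t /=.
rewrite in_itv/= andbT => t0; apply/cvgrPdist_lt => e e0.
rewrite near_withinE.
have ftinc s u : 0 <= s -> 0 <= u -> s < g u -> f s < u.
  by move=> s0 u0 sgu; rewrite -(fg _ u0) finc// g0.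
have ftinc' s u : 0 <= s -> 0 <= u -> g u < s -> u < f s.
  by move=> s0 u0 sgu; rewrite -(fg _ u0) finc// g0.
have tg : t < g (f t + e).
  have u0 : 0 <= f t + e by rewrite addr_ge0 ?f0// ltW.
  rewrite ltNge; apply/negP; rewrite le_eqVlt => /orP[/eqP gt|/(ftinc' _ _ t0 u0)].
    by have := fg _ u0; rewrite gt; move: e0; lra.
  by move: e0; lra.
have gt0 : 0 <= f t - e -> g (f t - e) < t.
  move=> u0.
  rewrite ltNge; apply/negP; rewrite le_eqVlt => /orP[/eqP gt|/(ftinc _ _ t0 u0)].
    by have := fg _ u0; rewrite -gt; move: e0; lra.
  by move: e0; lra.
have n1 : \forall s \near nbhs t, s < g (f t + e) by exact: lt_nbhsl.
have n2 : \forall s \near nbhs t, 0 <= f t - e -> g (f t - e) < s.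
  have [u0|u0] := leP 0 (f t - e); last by apply: nearW => s; lra.
  by apply: filterS (lt_nbhsr (gt0 u0)) => s.
near=> s; rewrite /= in_itv/= andbT => s0.
have h1 : f s < f t + e.
  apply: ftinc => //; first by rewrite addr_ge0 ?f0// ltW.
  by near: s.
have h2 : f t - e < f s.
  have [u0|u0] := leP 0 (f t - e); last by apply: lt_le_trans (f0 _ s0).
  by apply: ftinc' => //; move: u0; near: s.
by rewrite /from_subspace ltr_norml; apply/andP; split; move: h1 h2; lra.
Unshelve. all: by end_near. Qed.

(** The distortion function of a power quasisymmetry; [power_min] is its inverse on the
    half-line. *)
Definition power_max K al t := K * Num.max (t `^ al) (t `^ al^-1).
Definition power_min K al t := Num.min ((t / K) `^ al) ((t / K) `^ al^-1).

Variables (K al : R).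
Hypothesis K0 : 0 < K.
Hypothesis al01 : 0 < al <= 1.

Let al0 : 0 < al. Proof. by case/andP: al01. Qed.
Let alle : al <= al^-1.
Proof.
by case/andP: al01 => _ al1; apply: (le_trans al1); rewrite -invr1 lef_pV2 ?posrE.
Qed.
Let alV0 : 0 < al^-1. Proof. by rewrite invr_gt0. Qed.

Let low t : 0 <= t <= 1 -> t `^ al^-1 <= t `^ al.
Proof.
case/andP; rewrite le_eqVlt => /orP[/eqP <- _|t0 t1].
  by rewrite !powR0 ?gt_eqF.
by apply: ger_powR; rewrite ?t0.
Qed.

Let high t : 1 <= t -> t `^ al <= t `^ al^-1.
Proof. by move=> t1; apply: ler_powR. Qed.

Let pw t b : 0 < b -> 0 <= t -> (t `^ b <= 1) = (t <= 1).
Proof.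
move=> b0 t0; apply/idP/idP => h.
  rewrite leNgt; apply/negP => t1.
  have := gt0_ltr_powR b0; move=> /(_ 1 t); rewrite !nnegrE ler01 t0 powR1 => /(_ isT isT t1).
  by rewrite ltNge h.
have := ge0_ler_powR (ltW b0); move=> /(_ t 1); rewrite !nnegrE ler01 t0 powR1.
by apply.
Qed.

Lemma power_max_le1 t : 0 <= t <= 1 -> power_max K al t = K * t `^ al.
Proof. by move=> t01; rewrite /power_max max_l// low. Qed.

Lemma power_max_ge1 t : 1 <= t -> power_max K al t = K * t `^ al^-1.
Proof. by move=> t01; rewrite /power_max max_r// high. Qed.

Lemma power_max_ge0 t : 0 <= t -> 0 <= power_max K al t.
Proof. by move=> t0; rewrite mulr_ge0 ?(ltW K0)// le_max powR_ge0. Qed.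

Lemma power_min_ge0 t : 0 <= t -> 0 <= power_min K al t.
Proof. by move=> t0; rewrite le_min !powR_ge0. Qed.

Lemma power_maxK t : 0 <= t -> power_min K al (power_max K al t) = t.
Proof.
move=> t0; have [t1|t1] := leP t 1.
  have t01 : 0 <= t <= 1 by rewrite t0.
  rewrite power_max_le1// /power_min [K * _]mulrC mulfK ?gt_eqF//.
  rewrite min_r; first by rewrite -powRrM mulfV ?gt_eqF// powRr1.
  by apply: low; rewrite powR_ge0 pw.
rewrite power_max_ge1 ?(ltW t1)// /power_min [K * _]mulrC mulfK ?gt_eqF//.
rewrite min_l; first by rewrite -powRrM mulVf ?gt_eqF// powRr1.
by apply: high; rewrite leNgt; apply/negP => /ltW; rewrite pw// leNgt t1.
Qed.

Lemma power_minK t : 0 <= t -> power_max K al (power_min K al t) = t.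
Proof.
move=> t0; have tK0 : 0 <= t / K by rewrite divr_ge0// ltW.
rewrite /power_min; have [t1|t1] := leP (t / K) 1.
  rewrite min_r ?low ?tK0// power_max_le1 ?powR_ge0 ?pw//.
  by rewrite -powRrM mulVf ?gt_eqF// powRr1// mulrC mulfVK ?gt_eqF.
rewrite min_l ?high ?(ltW t1)// power_max_ge1.
  by rewrite -powRrM mulfV ?gt_eqF// powRr1// mulrC mulfVK ?gt_eqF.
by rewrite leNgt; apply/negP => /ltW; rewrite pw// leNgt t1.
Qed.

Lemma power_max_le s t : 0 <= s -> s <= t -> power_max K al s <= power_max K al t.
Proof.
move=> s0 st; have t0 := le_trans s0 st.
rewrite ler_wpM2l ?(ltW K0)// ge_max !le_max.
have le b : 0 <= b -> s `^ b <= t `^ b.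
  by move=> b0; apply: ge0_ler_powR; rewrite ?nnegrE.
by rewrite !le ?orbT ?(ltW al0)// ?(ltW alV0).
Qed.

Lemma power_max_lt s t : 0 <= s -> 0 <= t -> s < t -> power_max K al s < power_max K al t.
Proof.
move=> s0 t0 st; rewrite lt_neqAle power_max_le ?(ltW st)// andbT.
by apply/eqP => /(congr1 (power_min K al)); rewrite !power_maxK// => /eqP; rewrite lt_eqF.
Qed.

Lemma power_min_lt s t : 0 <= s -> 0 <= t -> s < t -> power_min K al s < power_min K al t.
Proof.
move=> s0 t0 st; rewrite ltNge; apply/negP => /(power_max_le (power_min_ge0 t0)).
by rewrite !power_minK// leNgt st.
Qed.

Lemma power_max_distortion : distortion_function (power_max K al).
Proof.
have itv0 t : (`[0, +oo[%classic t) = (0 <= t) :> Prop by rewrite /= in_itv/= andbT.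
split.
- split.
  + by move=> t /=; rewrite !in_itv/= !andbT; exact: power_max_ge0.
  + move=> s t /=; rewrite !inE/= !in_itv/= !andbT => s0 t0 /(congr1 (power_min K al)).
    by rewrite !power_maxK.
  + move=> t /=; rewrite in_itv/= andbT => t0; exists (power_min K al t).
      by rewrite /= in_itv/= andbT power_min_ge0.
    by rewrite power_minK.
- by move=> s t; rewrite !in_itv/= !andbT; exact: power_max_lt.
- exact: (increasing_can_continuous power_max_ge0 power_min_ge0 power_max_lt power_minK).
- exists (power_min K al).
    by move=> t; rewrite in_itv/= andbT; exact: power_maxK.
  exact: (increasing_can_continuous power_min_ge0 power_max_ge0 power_min_lt power_maxK).
Qed.

Lemma power_max_scale c t : 1 <= c -> 0 <= t ->
  power_max K al (c * t) <= c `^ al^-1 * power_max K al t.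
Proof.
move=> c1 t0; have c0 : 0 <= c by exact: le_trans c1.
rewrite /power_max mulrCA ler_wpM2l ?(ltW K0)//.
rewrite !powRM// ge_max maxr_pMr ?powR_ge0// !le_max lexx orbT andbT.
by rewrite ler_wpM2r ?powR_ge0// high.
Qed.

End power_distortion.

Section powR_extra.
Context {R : realType}.

Lemma exprn_powR (x b : R) n : 0 <= x -> (x ^+ n) `^ b = (x `^ b) ^+ n.
Proof.
by move=> x0; rewrite -!powR_mulrn ?powR_ge0// powRAC.
Qed.

(** While the scale changes by a factor [a], the p-th root of the weight changes by a factor between
    the p-th roots of [rho] and [1 - rho]. One exponent [al] turns both bounds into powers of
    [a]. *)
Lemma common_exponent (a p rho : R) : 1 < a -> 0 < p -> 0 < rho < 1 ->
  exists al, [/\ 0 < al <= 1, rho^-1 `^ p^-1 <= a `^ al^-1 &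
    (1 - rho) `^ p^-1 <= a^-1 `^ al].
Proof.
move=> a1 p0 /andP[r0 r1].
have a0 : 0 < a by apply: lt_trans a1.
have la : 0 < ln a by rewrite ln_gt0.
have r'0 : 0 < 1 - rho by rewrite subr_gt0.
have lr : 0 < - ln rho by rewrite oppr_gt0 ln_lt0// r0.
have lr' : 0 < - ln (1 - rho) by rewrite oppr_gt0 ln_lt0// r'0/= gtrBl.
pose al := Num.min 1 (Num.min (p * ln a / - ln rho) (- ln (1 - rho) / (p * ln a))).
have al0 : 0 < al by rewrite !lt_min ltr01 !divr_gt0// mulr_gt0.
have E x b : 0 < x -> x `^ b = expR (b * ln x) by move=> x0; rewrite /powR gt_eqF.
exists al; split.
- by rewrite al0 ge_min lexx.
- have h : al * - ln rho <= p * ln a.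
    by rewrite -ler_pdivlMr// !ge_min lexx orbT.
  rewrite !E// ?invr_gt0// lnV ?posrE// ler_expR.
  by rewrite ler_pdivrMl// mulrCA ler_pdivlMl.
- have h : al * (p * ln a) <= - ln (1 - rho).
    by rewrite -ler_pdivlMr ?mulr_gt0// !ge_min lexx !orbT.
  rewrite !E// ?invr_gt0// lnV ?posrE// ler_expR.
  by rewrite ler_pdivrMl//; lra.
Qed.

End powR_extra.

Section quasisymmetry.
Context {R : realType} {X : metricType R} {kappa a : R}.
Variable S : covering_system X kappa a.
Variable parent : forall n, S n.+1 -> S n.
Variables (p lambda s rho : R) (k1 : nat) (m : forall n, S n -> R).
Hypothesis p0 : 0 < p.
Hypothesis kappa1 : 1 <= kappa.
Hypothesis a_ge : 192 * kappa ^+ 2 <= a.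
Hypothesis par : is_parent parent.
Hypothesis s0 : 0 < s.
Hypothesis rho01 : 0 < rho < 1.
Hypothesis cw : conformal_weight parent p lambda s rho k1 m.
Variables (theta : distance R X) (CU cL : R).
Hypothesis CU0 : 0 < CU.
Hypothesis cL0 : 0 < cL.
Hypothesis theta_upper : forall n (B : S n) x y, val B x ->
  mdist x y <= 2 * kappa * a ^- n -> theta x y <= CU * diam_weight p m B.
Hypothesis theta_lower : forall n (B : S n) x y, val B x ->
  gap kappa a n < mdist x y -> cL * diam_weight p m B <= theta x y.

Local Notation wt := (diam_weight p m).
Implicit Types (x y z : X) (e d : R).

Let k0 : 0 < kappa. Proof. by move: kappa1; lra. Qed.
Let kk1 : 1 <= kappa ^+ 2. Proof. by rewrite exprn_ege1. Qed.
Let a192 : 192 <= a. Proof. by move: a_ge kk1; lra. Qed.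
Let a2 : 2 <= a. Proof. by move: a192; lra. Qed.
Let a1 : 1 <= a. Proof. by move: a192; lra. Qed.
Let a0 : 0 < a. Proof. by move: a192; lra. Qed.
Let r0 n : 0 < a ^- n. Proof. by rewrite invr_gt0 exprn_gt0. Qed.
Let rho0 : 0 < rho. Proof. by move: rho01; lra. Qed.
Let rho1 : 0 < 1 - rho. Proof. by move: rho01; lra. Qed.
Let rho1' : 1 - rho < 1. Proof. by move: rho01; lra. Qed.
Let pV0 : 0 < p^-1. Proof. by rewrite invr_gt0. Qed.
Let m0 n (B : S n) : 0 < m B. Proof. exact: (weight_gt0 rho01 cw). Qed.
Let wt0 n (B : S n) : 0 < wt B. Proof. exact: (wt_gt0 rho01 cw). Qed.

Lemma mdist_lt_diam x y : mdist x y < 2 * kappa.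
Proof.
have [B Bx] := level_coverP S 0 x.
have By : val B y.
  have : val B \in level S 0 by exact: fsvalP.
  by move: (val B) => C; rewrite (level0 S) inE => /eqP ->.
have := mdist_center_mem Bx; have := mdist_center_mem By; rewrite expr0 invr1.
have := metric_triangle x (center B) y; rewrite (metric_sym x (center B)); lra.
Qed.

Lemma weight_le_geom n (B : S n) : m B <= (1 - rho) ^- k1 * (1 - rho) ^+ n.
Proof.
have : forall B : S (n + 0)%N, m B <= (1 - rho) ^- k1 * (1 - rho) ^+ n.
  move=> C; have := weight_decay_ancestor rho01 cw C.
  by rewrite (weight_root cw) mulr1.
by rewrite addn0.
Qed.

Lemma weight_ge_geom n (B : S n) : rho ^+ n <= m B.
Proof.
have : forall B : S (n + 0)%N, rho ^+ n <= m B.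
  move=> C; have := weight_ge_ancestor rho01 cw C.
  by rewrite (weight_root cw) mulr1.
by rewrite addn0.
Qed.

Lemma wt_small e : 0 < e -> exists n0, forall n (B : S n), (n0 <= n)%N -> wt B <= e.
Proof.
move=> e0.
have e1 : 0 < (1 - rho) ^+ k1 * e `^ p by rewrite mulr_gt0 ?exprn_gt0 ?powR_gt0.
have [n0 n0P] : exists n0, forall n, (n0 <= n)%N -> (1 - rho) ^+ n <= (1 - rho) ^+ k1 * e `^ p.
  have : (fun n => (1 - rho) ^+ n) @ \oo --> (0 : R).
    by apply: cvg_expr; rewrite ger0_norm ?(ltW rho1).
  move=> /cvgrPdist_le/(_ _ e1)[n0 _ n0P]; exists n0 => n n0n.
  have := n0P n n0n; rewrite sub0r normrN ger0_norm// exprn_ge0// ltW//.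
exists n0 => n B n0n; rewrite /diam_weight -[leRHS](@powRr1 _ e) ?(ltW e0)//.
rewrite -(mulfV (lt0r_neq0 p0)) powRrM.
apply: ge0_ler_powR; rewrite ?nnegrE ?(ltW pV0) ?(ltW (m0 _)) ?powR_ge0//.
apply: (le_trans (weight_le_geom B)); rewrite ler_pdivrMl ?exprn_gt0//.
exact: n0P.
Qed.

Lemma theta_uniform e : 0 < e ->
  exists2 del : R, 0 < del & forall x y, mdist x y < del -> theta x y < e.
Proof.
move=> e0; have [|n0 n0P] := @wt_small (e / 2 / CU); first by rewrite !divr_gt0.
exists (2 * kappa * a ^- n0) => [|x y xy]; first by rewrite !mulr_gt0.
have [B Bx] := level_coverP S n0 x.
apply: (le_lt_trans (theta_upper Bx (ltW xy))).
have := n0P _ B (leqnn _); rewrite ler_pdivlMr// mulrC => h.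
by apply: (le_lt_trans h); move: e0; lra.
Qed.

Lemma mdist_uniform e : 0 < e ->
  exists2 del : R, 0 < del & forall x y, theta x y < del -> mdist x y < e.
Proof.
move=> e0; have [|n0 n0P] := @expVn_le_eps _ a (e / (6 * kappa)) a2.
  by rewrite divr_gt0// mulr_gt0.
exists (cL * (rho ^+ n0) `^ p^-1) => [|x y xy].
  by rewrite mulr_gt0// powR_gt0// exprn_gt0.
have [B Bx] := level_coverP S n0 x.
have h : mdist x y <= gap kappa a n0.
  rewrite leNgt; apply/negP => /(theta_lower Bx); rewrite leNgt => /negP; apply.
  apply: (lt_le_trans xy); rewrite ler_pM2l//.
  apply: ge0_ler_powR; rewrite ?nnegrE ?exprn_ge0 ?(ltW pV0) ?(ltW rho0) ?(ltW (m0 _))//.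
  exact: weight_ge_geom.
apply: (le_lt_trans h); rewrite /gap.
have := n0P _ (leqnn _); rewrite ler_pdivlMr ?mulr_gt0//.
by have := mulr_gt0 k0 (r0 n0); lra.
Qed.

Lemma id_homeomorphism : homeomorphism (fun x : X => x : metrized theta).
Proof.
split.
  move=> x A /nbhs_ballP[e e0 eA]; have [d d0 dP] := theta_uniform e0.
  apply/nbhs_ballP; exists d => // y; rewrite ballEmdist/= => /dP xy.
  by apply: eA; rewrite ballEmdist.
exists (fun x : metrized theta => x : X); split=> //.
move=> x A /nbhs_ballP[e e0 eA]; have [d d0 dP] := mdist_uniform e0.
apply/nbhs_ballP; exists d => // y; rewrite ballEmdist/= => /dP xy.
by apply: eA; rewrite ballEmdist.
Qed.

(** The finer cell is replaced by its ancestor at the level of the coarser one. Both are near [x],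
    so this comparison costs [e4]; between a cell and its ancestor, [weight_ge_ancestor] or
    [weight_decay_ancestor] is used, according to which level is finer. *)
Lemma wt_ratio : exists K al, [/\ 0 < K, 0 < al <= 1 &
  forall x N M (BN : S N) (BM : S M), val BN x -> val BM x ->
    wt BN <= power_max K al (a ^+ M / a ^+ N) * wt BM].
Proof.
have [|al [al01 h1 h2]] := @common_exponent R a p rho _ p0 rho01.
  by move: a192; lra.
have al0 : 0 < al by case/andP: al01.
pose e4 := expR (s * (4 * kappa) / p).
have e41 : 1 <= e4.
  by rewrite /e4 -expR0 ler_expR divr_ge0 ?mulr_ge0 ?(ltW s0) ?(ltW k0) ?(ltW p0).
pose c1 := ((1 - rho) ^- k1) `^ p^-1.
have c11 : 1 <= c1.
  have := @ge0_ler_powR R p^-1 (ltW pV0) 1 ((1 - rho) ^- k1).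
  rewrite !nnegrE powR1 invr_ge0 exprn_ge0 ?(ltW rho1)//; apply=> //.
  by rewrite invf_ge1 ?exprn_gt0// exprn_ile1 ?(ltW rho1) ?(ltW rho1').
have e40 : 0 < e4 by exact: lt_le_trans e41.
have c10 : 0 < c1 by exact: lt_le_trans c11.
have K0 : 0 < e4 * c1 by rewrite mulr_gt0.
have near n j (C : S n) (D : S (j + n)) x : val C x -> val D x ->
    mdist (center C) (center (ancestor parent D)) <= 4 * kappa * a ^- n.
  move=> Cx Dx; have d1 := mdist_center_mem Cx; have d2 := mdist_center_mem Dx.
  have d3 := ancestor_near2 kappa1 a_ge par D.
  have := metric_triangle (center C) x (center (ancestor parent D)).
  have := metric_triangle x (center D) (center (ancestor parent D)).
  rewrite (metric_sym x (center D)) (metric_sym (center D) (center (ancestor parent D))).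
  have := ler_wpM2l (ltW k0) (expVn_le kappa1 a_ge n j); lra.
exists (e4 * c1), al; split=> // x N M BN BM BNx BMx.
have [NM|/ltnW MN] := leqP N M.
  move: BM BMx; rewrite -(subnK NM) => BM BMx; set j := (M - N)%N in BM BMx *.
  have n1 := wt_lip p0 kappa1 a_ge s0 rho01 cw (near _ _ _ _ _ BNx BMx).
  apply: (le_trans n1); rewrite -/e4.
  have : wt (ancestor parent BM) <= (rho^-1 ^+ j) `^ p^-1 * wt BM.
    apply: (wt_le p0 rho01 cw); first by rewrite exprn_ge0// invr_ge0 ltW.
    rewrite exprVn ler_pdivlMl ?exprn_gt0//; exact: (weight_ge_ancestor rho01 cw).
  move=> h; apply: (le_trans (ler_wpM2l (ltW e40) h)).
  rewrite mulrA ler_wpM2r ?(ltW (wt0 _))//.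
  rewrite exprD mulfK ?gt_eqF ?exprn_gt0//.
  rewrite power_max_ge1 ?exprn_ege1// -mulrA ler_wpM2l ?(ltW e40)//.
  apply: (@le_trans _ _ ((a ^+ j) `^ al^-1)); last by rewrite ler_peMl ?powR_ge0.
  rewrite !exprn_powR ?invr_ge0 ?(ltW rho0) ?(ltW a0)//.
  by rewrite lerXn2r// nnegrE powR_ge0.
move: BN BNx; rewrite -(subnK MN) => BN BNx; set j := (N - M)%N in BN BNx *.
have n1 : wt (ancestor parent BN) <= e4 * wt BM.
  apply: (wt_lip p0 kappa1 a_ge s0 rho01 cw); rewrite metric_sym.
  exact: near BMx BNx.
have n2 : wt BN <= ((1 - rho) ^- k1 * (1 - rho) ^+ j) `^ p^-1 * wt (ancestor parent BN).
  apply: (wt_le p0 rho01 cw); last exact: (weight_decay_ancestor rho01 cw).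
  by rewrite mulr_ge0 ?invr_ge0 ?exprn_ge0 ?(ltW rho1).
apply: (le_trans n2); apply: (le_trans (ler_wpM2l (powR_ge0 _ _) n1)).
rewrite mulrA ler_wpM2r ?(ltW (wt0 _))//.
have -> : a ^+ M / a ^+ (j + M) = a^-1 ^+ j.
  by rewrite exprD invfM mulrCA mulfV ?gt_eqF ?exprn_gt0// mulr1 exprVn.
rewrite power_max_le1 ?exprn_ge0 ?invr_ge0 ?(ltW a0)//; last first.
  by rewrite exprn_ile1 ?invr_ge0 ?(ltW a0)// invf_le1.
rewrite powRM ?invr_ge0 ?exprn_ge0 ?(ltW rho1)// -/c1.
rewrite [leLHS]mulrAC [c1 * e4]mulrC.
rewrite ler_wpM2l ?mulr_ge0 ?(ltW e40) ?(ltW c10)//.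
rewrite !exprn_powR ?invr_ge0 ?(ltW rho1) ?(ltW a0)//.
by rewrite lerXn2r// nnegrE powR_ge0.
Qed.

Lemma theta_qs : qs_equivalent theta.
Proof.
split; first exact: id_homeomorphism.
have [K [al [K0 al01 KP]]] := wt_ratio.
have al0 : 0 < al by case/andP: al01.
have c1 : 1 <= a ^+ 3 by rewrite exprn_ege1.
pose K' := CU / cL * ((a ^+ 3) `^ al^-1) * K.
have K'0 : 0 < K'.
  by rewrite !mulr_gt0 ?invr_gt0// powR_gt0// (lt_le_trans _ c1).
exists (power_max K' al); first exact: power_max_distortion.
move=> x y z xy.
change (theta x z / theta x y <= power_max K' al (mdist x z / mdist x y)).
have dxy : 0 < mdist x y by rewrite mdist_gt0.
have [<-|xz] := eqVneq x z.
  rewrite distance_xx mul0r power_max_ge0// divr_ge0 ?mdist_ge0//.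
have dxz : 0 < mdist x z by rewrite mdist_gt0.
have scale d : 0 < d -> d < 2 * kappa ->
    exists n : nat, 2 * kappa * a ^- n.+1 < d <= 2 * kappa * a ^- n.
  move=> d0 dk; have ex : exists n, 2 * kappa * a ^- n < d.
    have [|n nP] := @expVn_le_eps _ a (d / (3 * kappa)) a2.
      by rewrite divr_gt0// mulr_gt0.
    exists n; have := nP _ (leqnn _); rewrite ler_pdivlMr ?mulr_gt0//.
    by have := mulr_gt0 k0 (r0 n); lra.
  case: (ex_minnP ex) => -[|n] nd nmin.
    by move: nd; rewrite expr0 invr1 mulr1 ltNge (ltW dk).
  exists n; rewrite nd/= leNgt; apply/negP => /nmin.
  by rewrite ltnn.
have [N /andP[N1 N2]] := scale _ dxz (mdist_lt_diam x z).
have [M /andP[M1 M2]] := scale _ dxy (mdist_lt_diam x y).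
have [BN BNx] := level_coverP S N x.
(* Level [M.+2], because [theta_lower] wants [gap M.+2] below [mdist x y], of which only
   [2 * kappa * r_(M+1) < mdist x y] is known. *)
have [BM BMx] := level_coverP S M.+2 x.
have up := theta_upper BNx N2.
have lo : cL * wt BM <= theta x y.
  apply: theta_lower BMx _; apply: le_lt_trans M1; rewrite /gap exprS invfM.
  rewrite [leLHS](_ : _ = (5 / a) * (kappa * a ^- M.+1)); last by ring.
  rewrite -[leRHS]mulrA ler_wpM2r ?mulr_ge0 ?(ltW k0) ?(ltW (r0 _))//.
  by rewrite ler_pdivrMr//; move: a192; lra.
have txy : 0 < theta x y by apply: lt_le_trans lo; rewrite mulr_gt0.
set T := mdist x z / mdist x y.
have T0 : 0 <= T by rewrite divr_ge0 ?mdist_ge0.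
(* Two of the three powers come from [M.+2], the third from the rounding of [mdist x z] to the scale
   of level [N]. *)
have uT : a ^+ M.+2 / a ^+ N <= a ^+ 3 * T.
  have aM := exprn_gt0 M a0; have aN := exprn_gt0 N a0.
  rewrite /T mulrA ler_pdivlMr//.
  apply: (@le_trans _ _ (a ^+ M.+2 / a ^+ N * (2 * kappa * a ^- M))).
    by rewrite ler_wpM2l// divr_ge0 ?exprn_ge0 ?(ltW a0).
  rewrite [leLHS](_ : _ = a ^+ 3 * (2 * kappa * a ^- N.+1)).
    by rewrite ler_wpM2l ?exprn_ge0 ?(ltW a0)// ltW.
  by rewrite !exprS; field; rewrite !gt_eqF.
rewrite ler_pdivrMr//; apply: (le_trans up).
have pm0 t : 0 <= t -> 0 <= power_max K al t by exact: power_max_ge0.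
apply: (@le_trans _ _ (CU * ((a ^+ 3) `^ al^-1 * power_max K al T) * wt BM)).
  rewrite -mulrA ler_wpM2l ?(ltW CU0)//; apply: (le_trans (KP _ _ _ _ _ BNx BMx)).
  rewrite ler_wpM2r ?(ltW (wt0 _))//.
  apply: le_trans (power_max_scale K0 al01 c1 T0).
  by apply: power_max_le => //; rewrite divr_ge0 ?exprn_ge0 ?(ltW a0).
rewrite [leLHS](_ : _ = power_max K' al T * (cL * wt BM)).
  by rewrite ler_wpM2l// power_max_ge0.
by rewrite /K' /power_max; field; rewrite gt_eqF.
Qed.

End quasisymmetry.

(** * Nested intervals attached to the cells *)

Section interval_subdivision.
Context {R : realType} {T : eqType}.
Variable w : T -> R.
Hypothesis w0 : forall i, 0 <= w i.

Fixpoint offset (r : seq T) (i : T) : R :=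
  if r is j :: r' then (if i == j then 0 else w j + offset r' i) else 0.

Lemma offset_ge0 r i : 0 <= offset r i.
Proof. by elim: r => //= j r IH; case: ifP => // _; rewrite addr_ge0. Qed.

Lemma offset_le r i : i \in r -> offset r i + w i <= \sum_(j <- r) w j.
Proof.
elim: r => //= j r IH; rewrite big_cons inE; case: eqVneq => /= [->|_ ir].
  by rewrite add0r lerDl sumr_ge0.
by rewrite -addrA lerD2l IH.
Qed.

Lemma offset_find r t : uniq r -> 0 <= t < \sum_(j <- r) w j ->
  exists2 i, i \in r & offset r i <= t < offset r i + w i.
Proof.
elim: r t => [|j r IH] t /=; first by rewrite big_nil leNgt andNb.
rewrite big_cons => /andP[jr ur] /andP[t0 tw]; have [tj|tj] := ltP t (w j).
  by exists j; rewrite ?mem_head// eqxx t0 add0r.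
have [|i ir /andP[h1 h2]] := IH (t - w j) ur.
  by rewrite subr_ge0 tj/= ltrBlDl.
have ij : i != j by apply: contraNneq jr => <-.
exists i; first by rewrite inE ir orbT.
by rewrite (negbTE ij); apply/andP; split; move: h1 h2; lra.
Qed.

Lemma offset_inj r i j t : uniq r -> i \in r -> j \in r ->
  offset r i <= t < offset r i + w i -> offset r j <= t < offset r j + w j -> i = j.
Proof.
elim: r t => //= k r IH t /andP[kr ur]; rewrite !inE.
case: eqVneq => [->|ik] /=; case: eqVneq => [->|jk] //= ir jr.
- rewrite add0r => /andP[_ h] /andP[h' _]; exfalso.
  by have := offset_ge0 r j; move: h h'; lra.
- rewrite add0r => /andP[h' _] /andP[_ h]; exfalso.
  by have := offset_ge0 r i; move: h h'; lra.
- move=> /andP[h1 h2] /andP[h3 h4]; apply: (IH (t - w k)) => //.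
    by move: h1 h2; lra.
  by move: h3 h4; lra.
Qed.

End interval_subdivision.

Section subdivision_tree.
Context {R : realType} {X : metricType R} {kappa a : R}.
Variable S : covering_system X kappa a.
Variable parent : forall n, S n.+1 -> S n.
Variables (m : forall n, S n -> R).
Hypothesis kappa1 : 1 <= kappa.
Hypothesis a_ge : 192 * kappa ^+ 2 <= a.
Hypothesis par : is_parent parent.
Hypothesis m0 : forall n (B : S n), 0 < m B.
Hypothesis m_root : forall B : S 0%N, m B = 1.
Hypothesis m_sum : forall n (B : S n),
  \sum_(B' : S n.+1 | parent B' == B) m B' = m B.

Definition children n (B : S n) : seq (S n.+1) := enum [pred B' | parent B' == B].

Lemma mem_children n (B : S n) B' : (B' \in children B) = (parent B' == B).
Proof. by rewrite mem_enum inE. Qed.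

Lemma sum_children n (B : S n) : \sum_(B' <- children B) m B' = m B.
Proof. by rewrite -m_sum big_enum. Qed.

Fixpoint left_end n : S n -> R :=
  if n is n'.+1 then
    fun B => left_end (parent B) + offset (@m n'.+1) (children (parent B)) B
  else fun=> 0.

(** Half-open, so that the intervals of one level partition [[0, 1[] and each point determines
    exactly one branch. *)
Definition weight_cell n (B : S n) : set R := [set t | left_end B <= t < left_end B + m B].

Lemma cell_parent n (B : S n.+1) : weight_cell B `<=` weight_cell (parent B).
Proof.
move=> t; rewrite /weight_cell/= => /andP[h1 h2].
have mge i : 0 <= m (n := n.+1) i by exact: ltW.
have := offset_ge0 mge (children (parent B)) B.
have := @offset_le _ _ _ mge (children (parent B)) B; rewrite mem_children => /(_ (eqxx _)).
by rewrite sum_children; move: h1 h2; lra.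
Qed.

Lemma cell_child n (B : S n) t : weight_cell B t ->
  exists2 B' : S n.+1, parent B' = B & weight_cell B' t.
Proof.
rewrite /weight_cell/= => /andP[h1 h2].
have mge i : 0 <= m (n := n.+1) i by exact: ltW.
have [|B'] := @offset_find _ _ (@m n.+1) (children B) (t - left_end B) (enum_uniq _).
  by rewrite sum_children; move: h1 h2; lra.
rewrite mem_children => /eqP B'B /andP[h3 h4]; exists B' => //=.
by rewrite B'B; move: h3 h4; lra.
Qed.

Lemma cell_inj n (B C : S n) t : weight_cell B t -> weight_cell C t -> B = C.
Proof.
elim: n B C => [|n IH] B C tB tC.
  have l0 (D : S 0%N) : val D = [set: X].
    have : val D \in level S 0 by exact: fsvalP.
    by move: (val D) => E; rewrite (level0 S) inE => /eqP.
  by apply: val_inj; rewrite !l0.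
have BC : parent B = parent C by apply: IH; exact: cell_parent.
move: tB tC; rewrite /weight_cell/= -BC => tB tC.
have mge i : 0 <= m (n := n.+1) i by exact: ltW.
apply: (@offset_inj _ _ _ mge (children (parent B)) _ _ (t - left_end (parent B))).
- exact: enum_uniq.
- by rewrite mem_children.
- by rewrite mem_children BC.
- by move: tB; lra.
- by move: tC; lra.
Qed.

Lemma cell_root (B : S 0%N) : weight_cell B = `[0, 1[%classic.
Proof.
by apply/seteqP; split => t; rewrite /weight_cell/= in_itv/= m_root add0r.
Qed.

Hypothesis X0 : X.

Lemma cell_cover n t : `[0, 1[%classic t -> exists B : S n, weight_cell B t.
Proof.
move=> t01; elim: n => [|n [B /cell_child[B' _ B't]]]; last by exists B'.
by have [B _] := level_coverP S 0 X0; exists B; rewrite cell_root.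
Qed.

(* [f t] is the end of the branch of the tree of cells that contains [t]. *)
Lemma tree_boundary_map : compact [set: X] -> exists f : R -> X,
  (forall t, ~ `[0, 1[%classic t -> f t = X0) /\
  (forall n (B : S n) t, weight_cell B t -> mdist (center B) (f t) <= 2 * kappa * a ^- n).
Proof.
move=> cX.
have a2 : 2 <= a.
  have : 1 <= kappa ^+ 2 by rewrite exprn_ege1.
  by move: a_ge; lra.
have a0 : 0 < a by move: a2; lra.
have k0 : 0 < kappa by move: kappa1; lra.
suff ex t : exists y : X, (~ `[0, 1[%classic t -> y = X0) /\
    (forall n (B : S n), weight_cell B t -> mdist (center B) y <= 2 * kappa * a ^- n).
  have [f fP] := choice ex; exists f; split=> [t|n B t]; first by have [] := fP t.
  by have [_] := fP t; apply.
have [t01|t01] := pselect (`[0, 1[%classic t); last first.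
  exists X0; split=> // n B tB; exfalso; apply: t01.
  elim: n B tB => [|n IH] B; first by rewrite cell_root.
  by move=> /cell_parent; exact: IH.
pose b n : S n := projT1 (cid (cell_cover n t01)).
have bP n : weight_cell (b n) t by exact: projT2 (cid (cell_cover n t01)).
have ba n j : ancestor parent (b (j + n)%N) = b n.
  elim: j n => //= j IH n; rewrite -[in RHS]IH; congr (ancestor _ _).
  apply: (cell_inj _ (bP _)); exact: (cell_parent (bP (j + n).+1)).
(* The end of the branch is taken as a cluster point of its centers; the tail of the branch stays
   within [2 * kappa * r_n] of [b n], and so does the cluster point. *)
pose F : set_system X := (fun n => center (b n)) @ \oo.
have [y [_ yF]] := cX F _ (filterT : F [set: X]).
exists y; split=> // n B tB; have -> : B = b n by exact: cell_inj tB (bP n).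
apply/ler_addgt0Pr => e e0.
have Fn : F [set z | mdist (center (b n)) z <= 2 * kappa * a ^- n].
  have near j : mdist (center (b n)) (center (b (j + n)%N)) <= 2 * kappa * a ^- n.
    by have := ancestor_near2 kappa1 a_ge par (b (j + n)%N); rewrite ba.
  by exists n => // j /= nj; have := near (j - n)%N; rewrite subnK.
have [z [/= h1]] := yF _ _ Fn (nbhsx_ballx y e e0).
rewrite ballEmdist/= => h2; have := metric_triangle (center (b n)) z y.
by rewrite (metric_sym z y); move: h1 h2; lra.
Qed.

End subdivision_tree.

(** * Finite Borel measures on compact metric spaces *)

Lemma metric_ball_open (R : realType) (Y : metricType R) (y : Y) (r : R) : open (ball y r).
Proof.
rewrite openE => z; rewrite ballEmdist/= => yz; apply/nbhs_ballP.
exists (r - mdist y z) => /=; first by rewrite subr_gt0.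
move=> u; rewrite !ballEmdist/= => zu; apply: (le_lt_trans (metric_triangle y z u)).
by rewrite -ltrBrDl.
Qed.

Section finite_borel_measure.
Context {R : realType} {Y : metricType R} (y0 : Y).
Variable mu : {measure set (borel y0) -> \bar R}.
Hypothesis cY : compact [set: Y].
Hypothesis mu_fin : (mu [set: borel y0] < +oo)%E.

Lemma borel_open (U : set Y) : open U -> measurable (U : set (borel y0)).
Proof. by move=> oU; exact: sub_gen_smallest. Qed.

Lemma borel_closed (F : set Y) : closed F -> measurable (F : set (borel y0)).
Proof.
move=> cF; have := borel_open (closed_openC cF) => /measurableC.
by rewrite setCK.
Qed.

Let fin (A : set (borel y0)) : measurable A -> (mu A < +oo)%E.
Proof.
move=> mA; apply: le_lt_trans mu_fin; apply: le_measure; rewrite ?inE//.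
Qed.

(** Approximation from inside by closed sets and from outside by open sets is asked at once, which
    makes the class stable under complement; it is then a sigma-algebra that contains the open
    sets. *)
Let approximable (A : set (borel y0)) := measurable A /\
  forall e : R, 0 < e -> exists (U F : set Y),
    [/\ open U, closed F, F `<=` A, A `<=` U & (mu (U `\` F) <= e%:E)%E].

Let decreasing_small (E : nat -> set (borel y0)) (b e : R) :
  (forall n, measurable (E n)) -> nonincreasing_seq E ->
  (mu (\bigcap_n E n) <= b%:E)%E -> b < e -> exists n, (mu (E n) <= e%:E)%E.
Proof.
move=> mE niE Eb be.
have cv : mu \o E @ \oo --> mu (\bigcap_n E n).
  by apply: nonincreasing_cvg_mu => //; [exact: fin|exact: bigcapT_measurable].
apply: contrapT => /forallNP h.
suff : (e%:E <= b%:E)%E by rewrite lee_fin leNgt be.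
apply: le_trans Eb; rewrite -(cvg_lim (@ereal_hausdorff R) cv).
apply: lime_ge; first by apply/cvg_ex; eexists; exact: cv.
by apply: nearW => n; rewrite ltW// ltNge; apply/negP/h.
Qed.

Let closed_inner (U : set Y) n := [set x : Y | forall y, ~ U y -> n.+1%:R^-1 <= mdist x y].

(** The closed sets [closed_inner U n] increase to [U], and for a finite measure the remainders tend
    to 0. *)
Let approximable_open (U : set Y) : open U -> approximable U.
Proof.
move=> oU; split; first exact: borel_open.
move=> e e0.
have cF n : closed (closed_inner U n).
  rewrite -openC; rewrite openE => x /= /existsNP[y /not_implyP[Uy /negP]].
  rewrite -ltNge => xy; apply/nbhs_ballP.
  exists (n.+1%:R^-1 - mdist x y) => /=; first by rewrite subr_gt0.
  move=> z; rewrite ballEmdist/= => xz /(_ _ Uy); apply/negP; rewrite -ltNge.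
  apply: (le_lt_trans (metric_triangle z x y)); rewrite (metric_sym z x).
  by rewrite -ltrBrDr.
have [n nP] : exists n, (mu (U `\` closed_inner U n) <= e%:E)%E.
  apply: (@decreasing_small (fun n => U `\` closed_inner U n) 0) => //.
  - by move=> n; apply: measurableD; [exact: borel_open|exact: borel_closed].
  - move=> i j ij; apply/subsetPset => x [Ux nx]; split=> // jx; apply: nx.
    move=> y /jx; apply: le_trans.
    by rewrite lef_pV2 ?posrE// ler_nat.
  - rewrite (_ : \bigcap_n _ = set0) ?measure0//.
    rewrite -subset0 => x Hx; have [Ux _] := Hx 0%N I.
    have /nbhs_ballP[d /= d0 dU] : nbhs x U by exact: open_nbhs_nbhs.
    have [_ []] := Hx (Num.trunc d^-1) I.
    move=> y Uy; rewrite leNgt; apply/negP => xy; apply: Uy; apply: dU.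
    rewrite ballEmdist/=; apply: (lt_trans xy).
    rewrite -[ltRHS]invrK ltf_pV2 ?posrE ?invr_gt0//.
    exact: truncnS_gt.
exists U, (closed_inner U n); split=> //.
move=> x xF; apply: contrapT => nU; have := xF _ nU; rewrite mdistxx leNgt.
by rewrite invr_gt0 ltr0Sn.
Qed.

Let approximable_sigma : sigma_algebra [set: borel y0] approximable.
Proof.
split.
- split=> // e e0; exists set0, set0; split=> //; [exact: open0|exact: closed0|].
  by rewrite setD0 measure0 lee_fin ltW.
- move=> A [mA hA]; split; first by rewrite setTD; exact: measurableC.
  move=> e /hA[U [F [oU cF FA AU UF]]]; exists (~` F), (~` U); split.
  + exact: closed_openC.
  + exact: open_closedC.
  + by rewrite setTD; exact: subsetC.
  + by rewrite setTD; exact: subsetC.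
  + by rewrite setDE setCK setIC -setDE.
- move=> A hA; split; first by apply: bigcupT_measurable => n; case: (hA n).
  move=> e e0.
  have hA' n : exists UF : set Y * set Y, [/\ open UF.1, closed UF.2, UF.2 `<=` A n,
      A n `<=` UF.1 & (mu (UF.1 `\` UF.2) <= (e / 2 / (2 ^ n.+1)%:R)%:E)%E].
    have [_ h] := hA n; have [|U [F h']] := h (e / 2 / (2 ^ n.+1)%:R).
      by rewrite !divr_gt0// ltr0n expn_gt0.
    by exists (U, F).
  have [UF UFP] := choice hA'.
  pose U := \bigcup_n (UF n).1.
  have oU : open U by apply: bigcup_open => n _; case: (UFP n).
  (* An infinite union of closed sets need not be closed: half of [e] is spent on the pieces, the
     other half on cutting the union at a finite stage. *)
  pose G n := \big[setU/set0]_(i < n) (UF i).2.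
  have GE k : G k = \bigcup_(i in `I_k) (UF i).2 by rewrite bigcup_mkord.
  have cG n : closed (G n) by apply: closed_bigsetU => i _; case: (UFP i).
  have [n nP] : exists n, (mu (U `\` G n) <= e%:E)%E.
    apply: (@decreasing_small (fun n => U `\` G n) (e / 2)).
    + by move=> n; apply: measurableD; [exact: borel_open|exact: borel_closed].
    + move=> i j ij; apply/subsetPset => x [Ux nx]; split=> // ix; apply: nx.
      move: ix; rewrite !GE => -[k /= ki Fx]; exists k => //=.
      exact: leq_trans ki ij.
    + apply: (@le_trans _ _ (\sum_(0 <= i <oo) mu ((UF i).1 `\` (UF i).2))%E).
        apply: measure_sigma_subadditive.
        * move=> n; have [oUn cFn _ _ _] := UFP n.
          by apply: measurableD; [exact: borel_open|exact: borel_closed].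
        * apply: bigcapT_measurable => n.
          by apply: measurableD; [exact: borel_open|exact: borel_closed].
        * move=> x Hx; have [[i _ Ux] _] := Hx 0%N I; exists i => //; split=> // Fx.
          have [_ []] := Hx i.+1 I; by rewrite GE; exists i => /=.
      apply: le_trans (epsilon_trick0 xpredT _); last by rewrite divr_ge0// ltW.
      by apply: lee_nneseries => // i _; case: (UFP i).
    + by move: e0; lra.
  exists U, (G n); split=> //.
    by rewrite GE => x [i _ Fx]; exists i => //; case: (UFP i) => _ _ + _ _; apply.
  by move=> x [i _ Ax]; exists i => //; case: (UFP i) => _ _ _ + _; apply.
Qed.

Lemma finite_borel_radon : radon mu.
Proof.
have approx A : measurable A -> approximable A.
  by apply: smallest_sub; [exact: approximable_sigma|exact: approximable_open].
split.
- by move=> K /(compact_closed (@metric_hausdorff _ Y)) /borel_closed /fin.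
- move=> A mA; apply/eqP; rewrite eq_le; apply/andP; split.
    apply/ereal_infP => _ [U [oU AU] <-].
    by apply: le_measure; rewrite ?inE//; exact: borel_open.
  apply/lee_addgt0Pr => e e0; have [_ /(_ e e0)[U [F [oU cF FA AU UF]]]] := approx _ mA.
  apply: (@le_trans _ _ (mu U)); first by apply: ereal_inf_lbound; exists U.
  have mU := borel_open oU; have mF := borel_closed cF.
  rewrite (measureDI mu mU mA) addeC leeD//.
    apply: le_measure; rewrite ?inE//; try exact: measurableI.
  apply: le_trans UF; apply: le_measure; rewrite ?inE//; try exact: measurableD.
  exact: setDS.
- move=> U oU; have mU := borel_open oU.
  apply/eqP; rewrite eq_le; apply/andP; split; last first.
    apply/ereal_supP => _ [K [cK KU] <-].
    apply: le_measure; rewrite ?inE//.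
    exact: borel_closed (compact_closed (@metric_hausdorff _ Y) cK).
  apply/lee_addgt0Pr => e e0; have [_ /(_ e e0)[V [F [oV cF FA AV UF]]]] := approx _ mU.
  have mF := borel_closed cF; have mV := borel_open oV.
  rewrite (measureDI mu mU mF) addeC leeD//.
    apply: (@le_trans _ _ (mu F)).
      apply: le_measure; rewrite ?inE//; try exact: measurableI.
    apply: ereal_sup_ubound; exists F => //; split=> //.
    by apply: subclosed_compact cY _.
  apply: le_trans UF; apply: le_measure; rewrite ?inE//; try exact: measurableD.
  exact: setSD.
Qed.

End finite_borel_measure.

(** * Ahlfors regularity *)

Lemma measure_bigsetU_le d (T : measurableType d) (R : realType)
    (mu : {measure set T -> \bar R}) (I : Type) (r : seq I) (P : pred I) (F : I -> set T) :
  (forall i, measurable (F i)) ->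
  (mu (\big[setU/set0]_(i <- r | P i) F i) <= \sum_(i <- r | P i) mu (F i))%E.
Proof.
move=> mF; elim: r => [|i r IH]; first by rewrite !big_nil measure0.
rewrite !big_cons; case: (P i) => //.
apply: le_trans (measureU2 _ _ _) _ => //; last by rewrite leeD2l.
exact: bigsetU_measurable.
Qed.

Section ahlfors_regularity.
Context {R : realType} {X : metricType R} {kappa a : R}.
Variable S : covering_system X kappa a.
Variable parent : forall n, S n.+1 -> S n.
Variables (p lambda s rho : R) (k1 : nat) (m : forall n, S n -> R).
Hypothesis p0 : 0 < p.
Hypothesis kappa1 : 1 <= kappa.
Hypothesis a_ge : 192 * kappa ^+ 2 <= a.
Hypothesis par : is_parent parent.
Hypothesis s0 : 0 < s.
Hypothesis rho01 : 0 < rho < 1.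
Hypothesis cw : conformal_weight parent p lambda s rho k1 m.
Hypothesis cX : compact [set: X].
Hypothesis expker_sum : forall n (x : X),
  \sum_(B : S n) @expker R X a s n x (center B) <= 2.
Variables (theta : distance R X) (CU cL : R).
Hypothesis CU0 : 0 < CU.
Hypothesis cL0 : 0 < cL.
Hypothesis theta_upper : forall n (B : S n) x y, val B x ->
  mdist x y <= 2 * kappa * a ^- n -> theta x y <= CU * diam_weight p m B.
Hypothesis theta_lower : forall n (B : S n) x y, val B x ->
  gap kappa a n < mdist x y -> cL * diam_weight p m B <= theta x y.

Local Notation wt := (diam_weight p m).
Local Notation cell := (weight_cell parent m).
Local Notation left_end := (left_end parent m).
Local Notation leb := (@lebesgue_measure R).
Implicit Types (x y z : X) (e d : R).

Let k0 : 0 < kappa. Proof. by move: kappa1; lra. Qed.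
Let kk1 : 1 <= kappa ^+ 2. Proof. by rewrite exprn_ege1. Qed.
Let a192 : 192 <= a. Proof. by move: a_ge kk1; lra. Qed.
Let a2 : 2 <= a. Proof. by move: a192; lra. Qed.
Let a1 : 1 <= a. Proof. by move: a192; lra. Qed.
Let a0 : 0 < a. Proof. by move: a192; lra. Qed.
Let r0 n : 0 < a ^- n. Proof. by rewrite invr_gt0 exprn_gt0. Qed.
Let rho0 : 0 < rho. Proof. by move: rho01; lra. Qed.
Let m0 n (B : S n) : 0 < m B. Proof. exact: (weight_gt0 rho01 cw). Qed.
Let wt0 n (B : S n) : 0 < wt B. Proof. exact: (wt_gt0 rho01 cw). Qed.

Let wtK n (B : S n) : wt B `^ p = m B.
Proof. by rewrite /diam_weight -powRrM mulVf ?gt_eqF// powRr1// ltW. Qed.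

Let q := expR (- (s * (4 * kappa))) * rho.
Let q0 : 0 < q. Proof. by rewrite mulr_gt0 ?expR_gt0. Qed.

(** [B] need not be the parent of [B'], but it is within [4 * kappa * r_n] of it. *)
Lemma weight_next n (B : S n) (B' : S n.+1) x : val B x -> val B' x -> q * m B <= m B'.
Proof.
move=> Bx B'x; apply: le_trans (weight_ge cw B').
rewrite /q [_ * rho]mulrC -mulrA ler_wpM2l ?(ltW rho0)//.
apply: le_trans (weight_lip cw B (parent B')); rewrite ler_wpM2r ?(ltW (m0 _))//.
apply: (expker_ge a1 (ltW s0)).
have d1 := mdist_center_mem Bx; have d2 := mdist_center_mem B'x.
have d3 := voronoi_near (par B').
have := metric_triangle (center B) x (center (parent B')).
have := metric_triangle x (center B') (center (parent B')).
rewrite (metric_sym x (center B')).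
have := ler_wpM2l (ltW k0) (expVn_le kappa1 a_ge n 1); rewrite add1n.
have := mulr_gt0 k0 (r0 n); lra.
Qed.

Section boundary_measure.
Variables (X0 : X) (f : R -> X).
Hypothesis f_out : forall t, ~ `[0, 1[%classic t -> f t = X0.
Hypothesis f_cell : forall n (B : S n) t, cell B t ->
  mdist (center B) (f t) <= 2 * kappa * a ^- n.

Let Y := metrized theta.
Let y0 : Y := X0.
Let D : set R := `[0, 1[%classic.
Let mD : measurable D. Proof. exact: measurable_itv. Qed.

Let fY : measurableTypeR R -> borel y0 := f.

Lemma cellE n (B : S n) : cell B = `[left_end B, left_end B + m B[%classic.
Proof. by apply/seteqP; split=> t; rewrite /weight_cell/= in_itv. Qed.

Lemma measurable_cell n (B : S n) : measurable (cell B).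
Proof. by rewrite cellE; exact: measurable_itv. Qed.

Lemma leb_cell n (B : S n) : leb (cell B) = (m B)%:E.
Proof.
by rewrite cellE lebesgue_measure_itv/= lte_fin ltrDl m0 -EFinD addrAC subrr add0r.
Qed.

Lemma cell_subset n (B : S n) : cell B `<=` D.
Proof.
elim: n B => [|n IH] B t; first by rewrite (cell_root parent (weight_root cw)).
by move/(cell_parent m0 (weight_sum cw)); exact: IH.
Qed.

Lemma theta_open (U : set Y) x : open U -> U x ->
  exists2 e, 0 < e & forall y, mdist x y < e -> U y.
Proof.
move=> oU Ux; have /nbhs_ballP[e /= e0 eU] : nbhs (x : Y) U by exact: open_nbhs_nbhs.
have [d d0 dP] := theta_uniform p0 kappa1 a_ge rho01 cw CU0 theta_upper e0.
by exists d => // y xy; apply: eU; rewrite ballEmdist/=; exact: dP.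
Qed.

(** This gives measurability of [f]: [t] belongs to the preimage as soon as some cell of its branch
    is so deep inside [U] that all ends of branches through it fall in [U]. *)
Lemma preimage_open (U : set Y) : open U ->
  f @^-1` U `&` D = \bigcup_n \big[setU/set0]_(B : S n |
    `[< forall y, mdist (center B) y <= 2 * kappa * a ^- n -> U y >]) cell B.
Proof.
move=> oU; apply/seteqP; split=> [t [/= Ut tD]|t [n _]].
  have [e e0 eU] := theta_open oU Ut.
  have [|n nP] := @expVn_le_eps _ a (e / (5 * kappa)) a2.
    by rewrite divr_gt0// mulr_gt0.
  have [B Bt] := cell_cover m0 (weight_root cw) (weight_sum cw) X0 n tD.
  exists n => //; rewrite -bigcup_seq_cond; exists B => //=.
  rewrite mem_index_enum; apply/asboolP => y By; apply: eU.
  have := nP n (leqnn _); rewrite ler_pdivlMr ?mulr_gt0//.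
  have := f_cell Bt; have := mulr_gt0 k0 (r0 n).
  have := metric_triangle (f t) (center B) y; rewrite (metric_sym (f t) (center B)); lra.
rewrite -bigcup_seq_cond => -[B /= /andP[_ /asboolP BU] Bt]; split; last exact: cell_subset Bt.
by apply: BU; exact: f_cell.
Qed.

Lemma measurable_boundary_map : measurable_fun [set: measurableTypeR R] fY.
Proof.
apply: (@measurability _ _ (measurableTypeR R) (borel y0) setT fY
  (@open Y : set (set Y))) => // _ [U oU <-].
rewrite setTI (_ : fY @^-1` U = (f @^-1` U `&` D) `|` (f @^-1` U `&` ~` D)); last first.
  by rewrite -setIUr setUv setIT.
apply: measurableU.
  rewrite preimage_open//; apply: bigcupT_measurable => n.
  by apply: bigsetU_measurable => B _; exact: measurable_cell.
have [UX|UX] := pselect (U X0).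
  rewrite (_ : _ `&` _ = ~` D); first exact: measurableC.
  by apply/seteqP; split=> [t []|t /= Dt]//; split=> //; rewrite /preimage/= f_out.
rewrite (_ : _ `&` _ = set0); first exact: measurable0.
by rewrite -subset0 => t [/= + /f_out ft]; rewrite ft.
Qed.

Lemma boundary_measure_exists : exists mu : {measure set (borel y0) -> \bar R},
  forall A, mu A = leb (f @^-1` A `&` D).
Proof.
pose nu (A : set (borel y0)) := mrestr leb mD (fY @^-1` A).
have mf (A : set (borel y0)) : measurable A -> measurable (fY @^-1` A).
  by move=> mA; rewrite -[X in measurable X]setTI; exact: measurable_boundary_map.
have nu0 : nu set0 = 0%E by rewrite /nu preimage_set0 measure0.
have nu_ge0 A : (0 <= nu A)%E.
  exact: measure_ge0.
have nu_sigma : semi_sigma_additive nu.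
  move=> F mF tF mUF; rewrite /nu preimage_bigcup.
  apply: measure_semi_sigma_additive.
  - by move=> n; exact: mf.
  - apply/trivIsetP => /= i j _ _ ij; rewrite -preimage_setI.
    by move/trivIsetP : tF => /(_ _ _ _ _ ij) ->//; rewrite preimage_set0.
  - by rewrite -preimage_bigcup; exact: mf.
pose mu : {measure set (borel y0) -> \bar R} :=
  HB.pack nu (isMeasure.Build _ _ _ nu nu0 nu_ge0 nu_sigma).
by exists mu.
Qed.

Variable mu : {measure set (borel y0) -> \bar R}.
Hypothesis muE : forall A, mu A = leb (f @^-1` A `&` D).

Let measurable_preimage (A : set (borel y0)) : measurable A -> measurable (f @^-1` A `&` D).
Proof.
move=> mA; apply: measurableI => //; rewrite -[X in measurable X]setTI.
exact: measurable_boundary_map.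
Qed.

Lemma boundary_measure_total : mu [set: borel y0] = 1%E.
Proof. by rewrite muE preimage_setT setTI lebesgue_measure_itv/= lte_fin ltr01 oppr0 adde0. Qed.

(** Only cells centered within [7 = 5 + 2] times [kappa * r_n] of [x] have branches that end in [A].
    Each weighs at most [exp(8 * s * kappa) * m B], and the kernel sum shows that there are at most
    [2 * exp(7 * s * kappa)] of them. *)
Lemma boundary_measure_upper n (B : S n) x (A : set Y) : val B x ->
  measurable (A : set (borel y0)) -> (forall y, A y -> mdist x y <= gap kappa a n) ->
  (mu A <= (2 * expR (s * (15 * kappa)) * m B)%:E)%E.
Proof.
move=> Bx mA Ax; have kr := mulr_gt0 k0 (r0 n).
rewrite muE; pose P (B' : S n) := mdist x (center B') <= 7 * kappa * a ^- n.
have sub : f @^-1` A `&` D `<=` \big[setU/set0]_(B' : S n | P B') cell B'.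
  move=> t [/= At tD].
  have [B' B't] := cell_cover m0 (weight_root cw) (weight_sum cw) X0 n tD.
  rewrite -bigcup_seq_cond; exists B' => //=; rewrite mem_index_enum /P.
  have := Ax _ At; have := f_cell B't; have := metric_triangle x (f t) (center B').
  rewrite (metric_sym (f t) (center B')) /gap; lra.
apply: (@le_trans _ _ (leb (\big[setU/set0]_(B' : S n | P B') cell B'))).
  apply: le_measure; rewrite ?inE//; first exact: measurable_preimage.
  by apply: bigsetU_measurable => B' _; exact: measurable_cell.
have := @measure_bigsetU_le _ (measurableTypeR R) R leb _ (index_enum _) P
  (fun B' : S n => cell B') (@measurable_cell n).
move=> /le_trans; apply.
rewrite (eq_bigr (fun B' : S n => (m B')%:E)); last by move=> B' _; exact: leb_cell.
rewrite sumEFin lee_fin.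
apply: (@le_trans _ _ (\sum_(B' : S n | P B') expR (s * (15 * kappa)) * m B *
    @expker R X a s n x (center B'))).
  apply: ler_sum => B' PB'.
  have h1 : m B' <= expR (s * (8 * kappa)) * m B.
    rewrite -ler_pdivrMl ?expR_gt0// -expRN.
    apply: le_trans (weight_lip cw B' B); rewrite ler_wpM2r ?(ltW (m0 _))//.
    apply: (expker_ge a1 (ltW s0)); have := mdist_center_mem Bx; move: PB'; rewrite /P.
    have := metric_triangle (center B') x (center B).
    rewrite (metric_sym (center B') x) (metric_sym x (center B)); lra.
  have h2 : 1 <= expR (s * (7 * kappa)) * @expker R X a s n x (center B').
    rewrite -ler_pdivrMl ?expR_gt0// mulr1 -expRN.
    exact: (expker_ge a1 (ltW s0)).
  apply: (le_trans h1).
  have -> : s * (15 * kappa) = s * (8 * kappa) + s * (7 * kappa) by ring.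
  rewrite expRD [leRHS](_ : _ = expR (s * (8 * kappa)) * m B *
    (expR (s * (7 * kappa)) * @expker R X a s n x (center B'))); last by ring.
  by rewrite ler_peMr// mulr_ge0 ?expR_ge0// ltW.
rewrite -mulr_sumr [leRHS](_ : _ = expR (s * (15 * kappa)) * m B * 2); last by ring.
rewrite ler_wpM2l ?mulr_ge0 ?expR_ge0 ?(ltW (m0 _))//.
apply: le_trans (expker_sum n x).
rewrite [leRHS](bigID P)/= lerDl sumr_ge0// => B' _; exact: expker_ge0.
Qed.

(** All branches through [B] end within [3 * kappa * r_(n+1)] of [x], which is below
    [2 * kappa * r_n]; hence the shift by one level. *)
Lemma boundary_measure_lower n (B : S n.+1) x (A : set Y) : val B x ->
  measurable (A : set (borel y0)) -> (forall y, mdist x y <= 2 * kappa * a ^- n -> A y) ->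
  ((m B)%:E <= mu A)%E.
Proof.
move=> Bx mA Ax; rewrite muE -leb_cell; apply: le_measure; rewrite ?inE.
- exact: measurable_cell.
- exact: measurable_preimage.
move=> t Bt; split; last exact: cell_subset Bt.
apply: Ax; have := f_cell Bt; have := mdist_center_mem Bx.
have := metric_triangle x (center B) (f t); rewrite (metric_sym x (center B)).
have : 2 * (kappa * a ^- n.+1) <= kappa * a ^- n.
  rewrite exprS invfM [leLHS](_ : _ = (2 / a) * (kappa * a ^- n)); last by ring.
  by rewrite ler_piMl ?(ltW (mulr_gt0 k0 (r0 n)))// ler_pdivrMr// mul1r.
have := mulr_gt0 k0 (r0 n); lra.
Qed.

(** Let [N] be the first level at which [c * wt (b N) < r], with [c = CU] for the lower bound and
    [c = cL] for the upper one. Below, the ball contains the ends of all branches through [b N.+1],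
    two levels after the last large cell, whence [q * q]. Above, the ball is at scale [N - 1], one
    level before, whence a single [q]; for [N = 0] the total mass 1 is used, whence the second term
    of [K1]. *)
Lemma boundary_measure_ball : exists2 K, 1 <= K & forall (y : Y) (r : R), 0 < r ->
  (r%:E <= ediam [set: Y])%E ->
  ((K^-1 * r `^ p)%:E <= mu (ball y r) /\ mu (ball y r) <= (K * r `^ p)%:E)%E.
Proof.
pose K1 := 2 * expR (s * (15 * kappa)) / q * cL^-1 `^ p + cL^-1 `^ p + 1.
pose K2 := CU `^ p / (q * q).
have cp0 : 0 <= cL^-1 `^ p by exact: powR_ge0.
have Aq0 : 0 <= 2 * expR (s * (15 * kappa)) / q.
  by rewrite !mulr_ge0 ?expR_ge0// invr_ge0 ltW.
have K11 : 1 <= K1 by rewrite lerDr addr_ge0// mulr_ge0.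
have K10 : 0 < K1 by exact: lt_le_trans K11.
have K20 : 0 <= K2 by exact: divr_ge0 (powR_ge0 _ _) (mulr_ge0 (ltW q0) (ltW q0)).
exists (K1 + K2); first by rewrite ler_wpDr.
move=> y r rr0 rdiam.
have rp : 0 < r `^ p by exact: powR_gt0.
have mball : measurable (ball y r : set (borel y0)) by apply: borel_open; exact: metric_ball_open.
have powlt c n (B : S n) : 0 < c -> c * wt B < r -> m B <= c^-1 `^ p * r `^ p.
  move=> c0 cr; rewrite -wtK -powRM ?invr_ge0 ?(ltW c0) ?(ltW rr0)//.
  apply: ge0_ler_powR; rewrite ?nnegrE ?(ltW p0) ?(ltW (wt0 _)) ?mulr_ge0 ?invr_ge0//;
    rewrite ?(ltW c0) ?(ltW rr0)//.
  by rewrite ler_pdivlMl// ltW.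
have powge c n (B : S n) : 0 < c -> r <= c * wt B -> r `^ p <= c `^ p * m B.
  move=> c0 cr; rewrite -wtK -powRM ?(ltW c0) ?(ltW (wt0 _))//.
  by apply: ge0_ler_powR; rewrite ?nnegrE ?(ltW p0) ?mulr_ge0 ?(ltW (wt0 _)) ?(ltW c0) ?(ltW rr0).
pose b n : S n := projT1 (cid (level_coverP S n y)).
have bP n : val (b n) y by exact: projT2 (cid (level_coverP S n y)).
have first_small c : 0 < c -> exists N, c * wt (b N) < r /\
    (forall n, (n < N)%N -> r <= c * wt (b n)).
  move=> c0; have ex : exists N, c * wt (b N) < r.
    have [|N NP] := @wt_small _ _ _ _ _ _ _ _ _ _ _ _ p0 rho01 cw (r / 2 / c).
      by rewrite !divr_gt0.
    exists N; have := NP N (b N) (leqnn _); rewrite ler_pdivlMr// mulrC => h.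
    by apply: (le_lt_trans h); move: rr0; lra.
  have [N NP Nmin] := ex_minnP ex; exists N; split=> // n nN.
  by rewrite leNgt; apply/negP => /Nmin; rewrite leqNgt nN.
split.
- have [N [N1 N2]] := first_small _ CU0.
  case: N N1 N2 => [|N] N1 N2.
    (* [N = 0] would mean [CU < r], since the root has weight 1, but [CU] bounds the diameter. *)
    exfalso; move: rdiam; apply/negP; rewrite -ltNge.
    apply: (@le_lt_trans _ _ (CU * wt (b 0%N))%:E); last by rewrite lte_fin.
    rewrite /ediam ge_max lee_fin mulr_ge0 ?(ltW CU0) ?(ltW (wt0 _))//=.
    apply/ereal_supP => _ [[u v] _ <-]; rewrite lee_fin/=.
    have -> : wt (b 0%N) = wt (projT1 (cid (level_coverP S 0 u))).
      by rewrite /diam_weight !(weight_root cw).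
    apply: (theta_upper (projT2 (cid (level_coverP S 0 u)))).
    by rewrite expr0 invr1 mulr1 ltW// (mdist_lt_diam S).
  have low := @boundary_measure_lower N.+1 (b N.+2) y (ball y r) (bP _) mball.
  apply: le_trans (low _); last first.
    move=> z yz; rewrite ballEmdist/=; apply: le_lt_trans N1.
    exact: theta_upper (bP _) yz.
  rewrite lee_fin.
  have h1 := weight_next (bP N) (bP N.+1); have h2 := weight_next (bP N.+1) (bP N.+2).
  have h3 := powge _ _ _ CU0 (N2 N (ltnSn _)).
  rewrite ler_pdivrMl; last by rewrite ltr_wpDr.
  apply: (@le_trans _ _ (K2 * m (b N.+2))); last first.
    by rewrite ler_wpM2r ?(ltW (m0 _))// lerDr ltW.
  apply: (le_trans h3); rewrite /K2 -mulrA ler_wpM2l ?powR_ge0//.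
  rewrite ler_pdivlMl ?(mulr_gt0 q0 q0)// -mulrA.
  by apply: le_trans h2; rewrite ler_wpM2l ?(ltW q0).
- have [N [N1 N2]] := first_small _ cL0.
  suff : (mu (ball y r) <= (K1 * r `^ p)%:E)%E.
    by move=> /le_trans; apply; rewrite lee_fin ler_wpM2r ?(ltW rp)// lerDl.
  have hN := powlt _ _ _ cL0 N1.
  case: N N1 N2 hN => [|N] N1 N2 hN.
    apply: (@le_trans _ _ 1%E).
      rewrite -boundary_measure_total; apply: le_measure; rewrite ?inE//.
    rewrite lee_fin; move: hN; rewrite (weight_root cw) => /le_trans; apply.
    by rewrite ler_wpM2r ?(ltW rp)// /K1 -addrA addrCA lerDl addr_ge0// mulr_ge0.
  have up := @boundary_measure_upper N (b N) y (ball y r) (bP _) mball.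
  apply: (le_trans (up _)).
    move=> z; rewrite ballEmdist/= => yz; rewrite leNgt; apply/negP => gz.
    have := theta_lower (bP N) gz; have := N2 N (ltnSn _).
    by move=> h1 h2; move: (le_trans h1 h2); rewrite leNgt yz.
  rewrite lee_fin; have h1 := weight_next (bP N) (bP N.+1).
  apply: (@le_trans _ _ (2 * expR (s * (15 * kappa)) / q * cL^-1 `^ p * r `^ p)).
    rewrite -!mulrA ler_wpM2l// ler_wpM2l ?expR_ge0//.
    by rewrite ler_pdivlMl//; apply: (le_trans h1).
  by rewrite ler_wpM2r ?(ltW rp)// /K1 -addrA lerDl addr_ge0 ?powR_ge0.
Qed.

End boundary_measure.

Lemma theta_ahlfors (X0 : X) : ahlfors_regular (metrized theta) p.
Proof.
have [f [f_out f_cell]] := tree_boundary_map kappa1 a_ge par m0 (weight_root cw)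
  (weight_sum cw) X0 cX.
have [mu muE] := boundary_measure_exists f_out f_cell.
have [K K1 KP] := boundary_measure_ball f_out f_cell muE.
exists X0, mu, K; split=> //.
apply: finite_borel_radon; last by rewrite (boundary_measure_total muE)// ltry.
have [ct _] := id_homeomorphism p0 kappa1 a_ge rho01 cw CU0 cL0 theta_upper theta_lower.
have := continuous_compact (f := fun x : X => x : metrized theta)
  (continuous_subspaceT ct) cX.
by rewrite image_id.
Qed.

End ahlfors_regularity.

(** * Hausdorff dimension and conclusion *)

Section hausdorff_dimension.
Context {R : realType} {X : metricType R} {kappa a : R}.
Variable S : covering_system X kappa a.
Variable parent : forall n, S n.+1 -> S n.
Variables (p lambda s rho : R) (k1 : nat) (m : forall n, S n -> R).
Hypothesis p0 : 0 < p.
Hypothesis rho01 : 0 < rho < 1.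
Hypothesis cw : conformal_weight parent p lambda s rho k1 m.
Variable X0 : X.
Variable theta : distance R X.
Hypothesis theta_cell : forall n (B : S n) x y, val B x -> val B y ->
  theta x y <= diam_weight p m B.

Local Notation wt := (diam_weight p m).
Local Notation Y := (metrized theta).

Let m0 n (B : S n) : 0 < m B. Proof. exact: (weight_gt0 rho01 cw). Qed.
Let wt0 n (B : S n) : 0 < wt B. Proof. exact: (wt_gt0 rho01 cw). Qed.

Lemma weight_total n : \sum_(B : S n) m B = 1.
Proof.
elim: n => [|n IH].
  have [B0 _] := level_coverP S 0 X0.
  rewrite (bigD1 B0)//= (weight_root cw) big1 ?addr0// => B /negP[].
  have l0 (D : S 0%N) : val D = [set: X].
    have : val D \in level S 0 by exact: fsvalP.
    by move: (val D) => E; rewrite (level0 S) inE => /eqP.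
  by apply/eqP; apply: val_inj; rewrite !l0.
rewrite (partition_big (@parent n) predT)//= -IH.
by apply: eq_bigr => B _; exact: (weight_sum cw).
Qed.

Lemma ediam_cell n (B : S n) : (ediam (val B : set Y) <= (wt B)%:E)%E.
Proof.
rewrite /ediam ge_max lee_fin (ltW (wt0 _))/=.
by apply/ereal_supP => _ [[x y] [/= Bx By] <-]; rewrite lee_fin; exact: theta_cell.
Qed.

Lemma ediam_ge0 (A : set Y) : (0 <= ediam A)%E.
Proof. by rewrite /ediam le_max lexx. Qed.

Lemma hausdorff_content_ge0 (t del : R) (A : set Y) : (0 <= hausdorff_content t del A)%E.
Proof.
apply/ereal_infP => _ [U _ <-]; apply: nneseries_ge0 => i _ _; exact: poweR_ge0.
Qed.

Lemma hausdorff_content_le (t del : R) n : 0 < t -> (forall B : S n, wt B <= del) ->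
  0 < del ->
  (hausdorff_content t del [set: Y] <= (\sum_(B : S n) wt B `^ t)%:E)%E.
Proof.
move=> t0 wdel del0; have [B0 _] := level_coverP S n X0.
pose l := index_enum (S n).
(* The finite cover is padded with empty sets, which add 0 to the series since their diameter is 0
   and [0 < t]. *)
pose U i : set Y := if (i < size l)%N then val (nth B0 l i) else set0.
have ediam0 : ediam (set0 : set Y) = 0%E.
  rewrite /ediam (_ : [set _ | _ in _] = set0) ?ereal_sup0 ?maxeNy//.
  by rewrite -subset0 => z [[x y] []].
have Udiam i : (i < size l)%N -> (ediam (U i) `^ t <= (wt (nth B0 l i) `^ t)%:E)%E.
  move=> il; rewrite /U il -poweR_EFin; apply: gt0_ler_poweR.
  - exact: ltW.
  - by rewrite in_itv/= leey ediam_ge0.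
  - by rewrite in_itv/= leey lee_fin ltW.
  - exact: ediam_cell.
apply: (@le_trans _ _ (\sum_(0 <= i <oo) ediam (U i) `^ t)%E).
  apply: ereal_inf_lbound; exists U => //; split.
    move=> i; rewrite /U; case: ifP => _; last by rewrite ediam0 lee_fin ltW.
    by apply: (le_trans (ediam_cell _)); rewrite lee_fin.
  move=> x _; have [B Bx] := level_coverP S n x.
  exists (index B l) => //; rewrite /U index_mem mem_index_enum nth_index//.
  exact: mem_index_enum.
rewrite (@nneseries_split _ _ 0 (size l)) => [|i _]; last exact: poweR_ge0.
rewrite add0n [X in (_ + X)%E]eseries0 ?adde0; last first.
  by move=> i il _; rewrite /U ltnNge il/= ediam0 poweR0r// gt_eqF.
rewrite -sumEFin (big_nth B0)/= !big_mkord; apply: lee_sum => i _.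
exact: Udiam.
Qed.

(** For the exponent [p + e] the cells of one level give the sum of [m B * wt B ^ e], at most the
    largest [wt B ^ e] because the weights of a level add up to 1; and [wt] tends to 0 uniformly. *)
Lemma hausdorff_dim_le : (hausdorff_dim Y <= p%:E)%E.
Proof.
apply/lee_addgt0Pr => e e0; rewrite -EFinD.
have t0 : 0 < p + e by rewrite addr_gt0.
apply: ereal_inf_lbound; exists (p + e) => //; split=> //.
apply/eqP; rewrite eq_le; apply/andP; split; last first.
  apply: ereal_sup_ge; exists (hausdorff_content (p + e) 1 [set: Y]).
    by exists 1 => //=.
  exact: hausdorff_content_ge0.
apply/ereal_supP => _ [del /= del0 <-].
apply/lee_addgt0Pr => c c0; rewrite add0e.
pose w := Num.min del (c `^ e^-1).
have w0 : 0 < w by rewrite lt_min del0 powR_gt0.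
have [n nP] := wt_small p0 rho01 cw w0.
have wn (B : S n) : wt B <= w by exact: nP.
apply: (le_trans (@hausdorff_content_le _ del n t0 _ del0)).
  by move=> B; apply: (le_trans (wn B)); rewrite ge_min lexx.
rewrite lee_fin -[leRHS]mul1r -(weight_total n) mulr_suml ler_sum// => B _.
rewrite powRD; last by rewrite gt_eqF.
have -> : wt B `^ p = m B by rewrite /diam_weight -powRrM mulVf ?gt_eqF// powRr1// ltW.
rewrite ler_wpM2l ?(ltW (m0 _))//.
apply: (@le_trans _ _ ((c `^ e^-1) `^ e)); last first.
  by rewrite -powRrM mulVf ?gt_eqF// powRr1// ltW.
apply: ge0_ler_powR; rewrite ?nnegrE ?powR_ge0 ?(ltW e0) ?(ltW (wt0 _))//.
by apply: (le_trans (wn B)); rewrite ge_min lexx orbT.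
Qed.

End hausdorff_dimension.

Theorem theorem2p9 (R : realType) (p lambda kappa KD : R) :
  0 < p -> 32 <= lambda -> 1 <= kappa -> 1 <= KD ->
  exists2 eta0 : R, 0 < eta0 < 1 &
    forall (X : metricType R) (KP a : R) (S : covering_system X kappa a)
           (parent : forall n, S n.+1 -> S n),
      compact [set: X] -> (exists x y : X, x != y) ->
      doubling X KD -> 1 < KP -> uniformly_perfect X KP ->
      6 * kappa ^+ 2 * Num.max lambda KP <= a ->
      is_parent parent ->
    forall sigma : forall n, S n -> R,
      (forall n (B : S n), 0 <= sigma n B) ->
      (forall k (B : S k) (gamma : seq (S k.+1)), Gamma lambda B gamma ->
         1 <= \sum_(C <- gamma) sigma k.+1 C) ->
      (forall k (B : S k),
         \sum_(B' : S k.+1 | parent k B' == B) sigma k.+1 B' `^ p <= eta0) ->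
    (exists theta : distance R X,
       qs_equivalent theta /\ ahlfors_regular (metrized theta) p) /\
    (ar_conformal_dim X <= p%:E)%E.
Proof.
move=> p0 lambda32 kappa1 KD1.
have k0 : 0 < kappa by lra.
have kk1 : 1 <= kappa ^+ 2 by rewrite exprn_ege1.
have KD0 : 0 < KD by lra.
(* The logarithm is what gives [KD * exp(- s1 / (4 * kappa)) <= 1/2]; the summand 4 gives
   [4 <= s1]. *)
pose s1 := 4 * kappa * ln (2 * KD) + 4.
have ln0 : 0 <= ln (2 * KD) by rewrite ln_ge0//; lra.
have s1_ge : 4 <= s1 by rewrite lerDr !mulr_ge0// ltW.
have s1_KD : KD * expR (- (s1 / (4 * kappa))) <= 2^-1.
  apply: (@le_trans _ _ (KD * expR (- ln (2 * KD)))).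
    rewrite ler_wpM2l ?(ltW KD0)// ler_expR lerN2 ler_pdivlMr ?mulr_gt0//.
    by rewrite /s1 mulrC lerDl.
  rewrite expRN lnK ?posrE ?mulr_gt0// invfM mulrCA mulfV ?gt_eqF// mulr1.
  by [].
pose s := 16 * kappa ^+ 2 * s1.
have s0 : 0 < s by rewrite !mulr_gt0 ?exprn_gt0//; lra.
have s1s : s1 <= s by rewrite /s ler_peMl//; lra.
pose A := 2 `^ p * expR (s * (2 * lambda * kappa)) * expR (s * (4 * kappa)).
have A0 : 0 < A by rewrite !mulr_gt0 ?expR_gt0// powR_gt0.
pose C := A * expR (s * (4 * kappa)) * 4.
have C0 : 0 < C by rewrite !mulr_gt0 ?expR_gt0.
(* [4^-1 / C] is the bound required in [smooth_weight_sum_le], and [2^-1] keeps the threshold below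
   1. Neither involves [a], [KP] or [X]. *)
exists (Num.min 2^-1 (4^-1 / C)).
  rewrite lt_min invr_gt0 ltr0n divr_gt0 ?invr_gt0//= gt_min invf_lt1 ?ltr1n//.
set eps0 := Num.min _ _.
have eps0_le : A * expR (s * (4 * kappa)) * 4 * eps0 <= 4^-1.
  by rewrite -/C -ler_pdivlMl// [leRHS]mulrC ge_min lexx orbT.
move=> X KP a S parent cX X2 dbl KP1 perf a_ge par sigma sigma0 spath ssum.
have [rho [k1 [m [rho01 cw]]]] := conformal_weight_exists p0 lambda32 kappa1 KD1 dbl
  KP1 perf X2 a_ge par s1_ge s1_KD eps0_le sigma0 spath ssum.
have a192 : 192 * kappa ^+ 2 <= a.
  apply: le_trans a_ge; rewrite (_ : 192 * _ = 6 * kappa ^+ 2 * 32); last by ring.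
  by rewrite ler_wpM2l ?le_max ?lambda32//; lra.
pose theta := chain_distance p0 lambda32 kappa1 a192 par s0 rho01 cw.
pose CU := 1 + expR (s * (4 * kappa) / p).
pose cL := expR (- (s * (10 * kappa) / p)).
have CU0 : 0 < CU by rewrite addr_gt0 ?expR_gt0.
have cL0 : 0 < cL by exact: expR_gt0.
have thU := theta_upper p0 kappa1 a192 s0 rho01 cw.
have thL := theta_lower p0 lambda32 kappa1 a192 par s0 rho01 cw.
have [x0 [_ _]] := X2.
have ker n x : \sum_(B : S n) @expker R X a s n x (center B) <= 2.
  apply: (@expker_sum_le R X kappa a S kappa1 _ KD s n x _ KD1 dbl); first by lra.
    exact: ltW.
  apply: le_trans s1_KD; rewrite ler_wpM2l ?(ltW KD0)// ler_expR lerN2.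
  by rewrite ler_wpM2r// invr_ge0 mulr_ge0// ltW.
have qs : qs_equivalent theta :=
  theta_qs p0 kappa1 a192 par s0 rho01 cw (theta := theta) CU0 cL0 thU thL.
have ar : ahlfors_regular (metrized theta) p :=
  theta_ahlfors p0 kappa1 a192 par s0 rho01 cw cX ker (theta := theta) CU0 cL0 thU thL x0.
split; first by exists theta.
apply: (@le_trans _ _ (hausdorff_dim (metrized theta))).
  by apply: ereal_inf_lbound; exists theta => //; split=> //; exists p.
apply: (hausdorff_dim_le p0 rho01 cw x0) => n B x y.
exact: (theta_le_wt p m kappa1 a192).
Qed.
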